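(* Let $(G,\pi_G)$ be a connected and simply connected Poisson Lie group acting on a Poisson manifold $(M,\pi)$, and let $\tilde\varphi:\mathfrak g\to\Omega^1(M)$ be an infinitesimal momentum map generating this action. Then the action is a Poisson action, i.e. the action map $\Phi:G\times M\to M$ is a Poisson map, where $G\times M$ carries the product Poisson structure $\pi_G\oplus\pi$.
   Context: Conventions. For a Poisson manifold $(M,\pi)$: $\{f,g\}=\pi(df,dg)$, $\pi^\sharp(\alpha)=\pi(\alpha,\cdot)$, and $[\alpha,\beta]_\pi=\mathcal L_{\pi^\sharp\alpha}\beta-\mathcal L_{\pi^\sharp\beta}\alpha-d(\pi(\alpha,\beta))$ is the Lie bracket on $\Omega^1(M)$. A Poisson Lie group $(G,\pi_G)$ is a Lie group with a multiplicative Poisson structure; its Lie algebra $\mathfrak g$ carries the $1$-cocycle $\delta=d_e\pi_G:\mathfrak g\to\mathfrak g\wedge\mathfrak g$, where $\delta(\xi)=(\mathcal L_X\pi_G)(e)$ for any vector field $X$ on $G$ with $X(e)=\xi$. The infinitesimal generator of an action $\Phi$ is $\varphi:\mathfrak g\to\Gamma(TM)$, $\varphi(\xi)(m)=\frac{d}{dt}|_{t=0}\Phi(\exp(t\xi),m)$; the bracket of $\mathfrak g$ is normalized so that $\varphi$ is a Lie algebra homomorphism (i.e. it is the bracket of right-invariant vector fields). An infinitesimal momentum map for the action is a linear map $\tilde\varphi:\mathfrak g\to\Omega^1(M)$, $\xi\mapsto\tilde\varphi_\xi$, such that (i) $\tilde\varphi_{[\xi,\eta]}=[\tilde\varphi_\xi,\tilde\varphi_\eta]_\pi$;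 (ii) $d\tilde\varphi_\xi=(\tilde\varphi\wedge\tilde\varphi)(\delta(\xi))$; (iii) $\varphi(\xi)=\pi^\sharp(\tilde\varphi_\xi)$. *)

(* Defs.v *)
From HB Require Import structures.
From mathcomp Require Import all_boot all_order all_algebra.
From mathcomp Require Import boolp classical_sets functions cardinality reals topology normedtype landau derive.
From mathcomp Require Import ring.
Import Order.TTheory GRing.Theory Num.Theory.
Import numFieldNormedType.Exports.

Set Implicit Arguments.
Unset Strict Implicit.
Unset Printing Implicit Defensive.

Local Open Scope classical_set_scope.
Local Open Scope ring_scope.

Section Ck.
Context {R : realType}.

(* [f] is C^k at [x]; meaningful when required at all points of an open set. *)
Fixpoint Ck (n k : nat) (f : 'rV[R]_n -> R) (x : 'rV[R]_n) : Prop :=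
  if k is k'.+1 then
    differentiable f x /\
    forall i : 'I_n, Ck k' (fun y => 'D_(delta_mx 0 i) f y) x
  else {for x, continuous f}.

Definition Ck_on (n k : nat) (U : set 'rV[R]_n) (f : 'rV[R]_n -> R) :=
  forall x, U x -> Ck k f x.

Definition smooth_on (n : nat) (U : set 'rV[R]_n) (f : 'rV[R]_n -> R) :=
  forall k, Ck_on k U f.

Lemma CkW n k (f : 'rV[R]_n -> R) x : Ck k.+1 f x -> Ck k f x.
Proof.
elim: k f => [|k IH] f; first by case=> /differentiable_continuous.
by case=> df Df; split => // i; apply: IH; exact: Df.
Qed.

Lemma near_differentiable n (f g : 'rV[R]_n -> R) x :
  (\forall y \near x, f y = g y) -> differentiable f x -> differentiable g x.
Proof.
move=> fg df.
have gx : g \o shift x = cst (g x) + 'd f x +o_ 0 id.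
  apply/eqaddoP => e e0.
  have /diff_locally/eqaddoP/(_ e e0) := df.
  have : \forall h \near (0 : 'rV[R]_n), f (h + x) = g (h + x).
    by move: fg; rewrite (near_shift 0); apply: filterS => h /=; rewrite subr0.
  apply: filterS2 => h; rewrite -(nbhs_singleton fg).
  by rewrite !fctE /= => ->.
have dgf := diff_unique (diff_continuous df) gx.
by apply/diff_locallyP; rewrite dgf; split => //; exact: diff_continuous.
Qed.

Lemma near_Ck n k (f g : 'rV[R]_n -> R) x :
  (\forall y \near x, f y = g y) -> Ck k f x -> Ck k g x.
Proof.
elim: k f g x => [|k IH] f g x fg.
  rewrite /= /prop_for /continuous_at -(nbhs_singleton fg) => h.
  by apply: cvg_trans h; apply: (@near_eq_cvg _ _ (nbhs x) _ f g fg).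
case=> df Df; split; first exact: near_differentiable fg df.
move=> i; apply: IH (Df i).
have := near_join fg; apply: filterS => y yfg.
exact: near_eq_derive.
Qed.

Lemma eq_Ck_on n k (U : set 'rV[R]_n) (f g : 'rV[R]_n -> R) :
  open U -> {in U, f =1 g} -> Ck_on k U f -> Ck_on k U g.
Proof.
move=> oU fg Cf x Ux; apply: near_Ck (Cf x Ux).
by apply: filterS (open_nbhs_nbhs (conj oU Ux)) => y Uy; rewrite fg ?inE.
Qed.

Lemma Ck_cst n k (a : R) (x : 'rV[R]_n) : Ck k (cst a) x.
Proof.
elim: k a => [|k IH] a; first exact: cst_continuous.
split; first exact: differentiable_cst.
move=> i; rewrite (_ : (fun _ => _) = cst 0); first exact: IH.
by apply/funext => y; rewrite derive_cst.
Qed.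

Lemma Ck_onD n k (U : set 'rV[R]_n) (f g : 'rV[R]_n -> R) :
  open U -> Ck_on k U f -> Ck_on k U g -> Ck_on k U (f + g).
Proof.
move=> oU; elim: k f g => [|k IH] f g Cf Cg x Ux.
  exact: continuousD (Cf x Ux) (Cg x Ux).
split; first exact: differentiableD (Cf x Ux).1 (Cg x Ux).1.
move=> i.
apply: (@eq_Ck_on _ _ U (fun y => 'D_(delta_mx 0 i) f y + 'D_(delta_mx 0 i) g y)) => //.
  move=> y /[1!inE] Uy; rewrite deriveD //; apply: diff_derivable.
    exact: (Cf y Uy).1.
  exact: (Cg y Uy).1.
by apply: IH => // y Uy; [exact: (Cf y Uy).2|exact: (Cg y Uy).2].
Qed.

Lemma Ck_onM n k (U : set 'rV[R]_n) (f g : 'rV[R]_n -> R) :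
  open U -> Ck_on k U f -> Ck_on k U g -> Ck_on k U (f * g).
Proof.
move=> oU; elim: k f g => [|k IH] f g Cf Cg x Ux.
  exact: continuousM (Cf x Ux) (Cg x Ux).
split; first exact: differentiableM (Cf x Ux).1 (Cg x Ux).1.
move=> i.
apply: (@eq_Ck_on _ _ U (f * (fun y => 'D_(delta_mx 0 i) g y) +
                         g * (fun y => 'D_(delta_mx 0 i) f y))) => //.
  move=> y /[1!inE] Uy; rewrite deriveM //; apply: diff_derivable.
    exact: (Cf y Uy).1.
  exact: (Cg y Uy).1.
apply: Ck_onD => //; apply: IH => // y Uy;
  by [exact: (Cf y Uy).2|exact: (Cg y Uy).2|exact/CkW/Cf|exact/CkW/Cg].
Qed.

Lemma Ck_on_sum n k (U : set 'rV[R]_n) m (f : 'I_m -> 'rV[R]_n -> R) :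
  open U -> (forall j, Ck_on k U (f j)) -> Ck_on k U (\sum_j f j).
Proof.
move=> oU Cf; elim/big_ind : _ => //; first by move=> x _; exact: Ck_cst.
by move=> g h; exact: Ck_onD.
Qed.

Lemma differentiable_rV n m (F : 'rV[R]_n -> 'rV[R]_m) x :
  (forall j, differentiable (fun y => F y 0 j) x) -> differentiable F x.
Proof.
move=> dF; rewrite (_ : F = \sum_j (fun y => F y 0 j *: delta_mx 0 j)).
  by apply: differentiable_sum => j; exact: differentiableZl.
by apply/funext => y; rewrite fct_sumE; exact: row_sum_delta.
Qed.

Lemma derive_comp_rV n m (F : 'rV[R]_n -> 'rV[R]_m) (f : 'rV[R]_m -> R) x v :
  (forall j, differentiable (fun y => F y 0 j) x) -> differentiable f (F x) ->
  'D_v (f \o F) x =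
    \sum_j 'D_(delta_mx 0 j) f (F x) * 'D_v (fun y => F y 0 j) x.
Proof.
move=> dFj df; have dF := differentiable_rV dFj.
rewrite deriveE; last exact: differentiable_comp.
rewrite diff_comp //= -[X in 'd f _ X](deriveE v dF).
rewrite derive_mx; last exact: diff_derivable.
rewrite [X in 'd f _ X]row_sum_delta linear_sum /=.
apply: eq_bigr => j _; rewrite linearZ /= mxE [in RHS]mulrC -(deriveE _ df).
by [].
Qed.

Lemma Ck_on_comp n m k (U : set 'rV[R]_n) (F : 'rV[R]_n -> 'rV[R]_m)
    (f : 'rV[R]_m -> R) :
  open U -> (forall j, Ck_on k.+1 U (fun y => F y 0 j)) ->
  (forall x, U x -> Ck k f (F x)) -> Ck_on k U (f \o F).
Proof.
move=> oU; elim: k f => [|k IH] f CF Cf x Ux.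
  apply: continuous_comp; last exact: Cf.
  by apply: differentiable_continuous; apply: differentiable_rV => j; apply: (CF j x Ux).1.
have dFj y : U y -> forall j, differentiable (fun y => F y 0 j) y.
  by move=> Uy j; exact: (CF j y Uy).1.
split; first by apply: differentiable_comp (Cf x Ux).1; exact/differentiable_rV/dFj.
move=> i; apply: (@eq_Ck_on _ _ U (\sum_j
    ((fun y => 'D_(delta_mx 0 j) f y) \o F) *
    (fun y => 'D_(delta_mx 0 i) (fun y => F y 0 j) y))) => //.
  move=> y /[1!inE] Uy; rewrite derive_comp_rV ?fct_sumE //; first exact: dFj.
  exact: (Cf y Uy).1.
apply: Ck_on_sum => // j; apply: Ck_onM => //.
  apply: IH => [l y Uy|y Uy]; first exact/CkW/CF.
  exact: (Cf y Uy).2.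
by move=> y Uy; apply/CkW; exact: (CF j y Uy).2.
Qed.

Lemma Ck_coord n k (j : 'I_n) (x : 'rV[R]_n) : Ck k (fun y : 'rV[R]_n => y 0 j) x.
Proof.
case: k => [|k]; first exact: coord_continuous.
split=> [|i]; first exact: differentiable_coord.
rewrite (_ : (fun _ => _) = cst ((delta_mx 0 i : 'rV[R]_n) 0 j)); first exact: Ck_cst.
apply/funext => y; have /matrixP/(_ 0 j) := derive_mx (@derivable_id _ _ y (delta_mx 0 i)).
by rewrite derive_id mxE => ->; rewrite mxE.
Qed.

End Ck.

Record chart (R : realType) (T : topologicalType) (n : nat) := Chart {
  chart_dom : set T;
  chart_cod : set 'rV[R]_n;
  chart_fun :> T -> 'rV[R]_n;
  chart_inv : 'rV[R]_n -> T;
  chart_dom_open : open chart_dom;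
  chart_cod_open : open chart_cod;
  chart_funP : forall p, chart_dom p -> chart_cod (chart_fun p);
  chart_invP : forall x, chart_cod x -> chart_dom (chart_inv x);
  chart_funK : forall p, chart_dom p -> chart_inv (chart_fun p) = p;
  chart_invK : forall x, chart_cod x -> chart_fun (chart_inv x) = x;
  chart_fun_continuous : forall p, chart_dom p -> {for p, continuous chart_fun};
  chart_inv_continuous : forall x, chart_cod x -> {for x, continuous chart_inv}
}.

(* [F] read in the charts [c] and [d], on the open set where this makes sense,
   has smooth coordinates *)
Definition smooth_in_charts (R : realType) (T U : topologicalType) (n m : nat)
    (c : chart R T n) (d : chart R U m) (F : T -> U) :=
  forall j : 'I_m,
    smooth_on [set x | chart_cod c x /\ chart_dom d (F (chart_inv c x))]
      (fun x => d (F (chart_inv c x)) 0 j).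

(* Finite-dimensional, Hausdorff and second countable; the atlas is not required
   to be maximal. *)
Record manifold (R : realType) := Manifold {
  manifold_space :> topologicalType;
  manifold_dim : nat;
  atlas : set (chart R manifold_space manifold_dim);
  manifold_hausdorff : hausdorff_space manifold_space;
  manifold_second_countable : @second_countable manifold_space;
  atlas_cover : forall p, exists2 c, atlas c & chart_dom c p;
  atlas_compatible : forall c d, atlas c -> atlas d -> smooth_in_charts c d id
}.

Definition is_smooth_map (R : realType) (M N : manifold R) (F : M -> N) :=
  continuous F /\
  forall c d, atlas c -> atlas d -> smooth_in_charts c d F.

Definition is_smooth_fun (R : realType) (M : manifold R) (f : M -> R) :=
  forall c, atlas c -> smooth_on (chart_cod c) (f \o chart_inv c).

Record smooth_map (R : realType) (M N : manifold R) := SmoothMap {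
  smooth_map_fun :> M -> N;
  smooth_mapP : is_smooth_map smooth_map_fun
}.

Section product_manifold.
Context {R : realType}.

Lemma continuous_lin1 n m (f : {linear 'rV[R]_n -> 'rV[R]_m}) : continuous f.
Proof.
rewrite (_ : (f : _ -> _) = \sum_i (fun x : 'rV[R]_n => x 0 i *: f (delta_mx 0 i))).
  move=> x; apply: differentiable_continuous.
  apply: differentiable_sum => i.
  exact/differentiableZl/differentiable_coord.
apply/funext => x; rewrite fct_sumE [in LHS](row_sum_delta x) linear_sum.
by apply: eq_bigr => i _; rewrite linearZ.
Qed.

Lemma continuous_row_mx n m (T : topologicalType) (f : T -> 'rV[R]_n)
    (g : T -> 'rV[R]_m) t :
  {for t, continuous f} -> {for t, continuous g} ->
  {for t, continuous (fun t => row_mx (f t) (g t))}.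
Proof.
move=> cf cg.
pose L : {linear 'rV[R]_n -> 'rV[R]_(n + m)} := mulmxr (row_mx 1%:M 0).
pose K : {linear 'rV[R]_m -> 'rV[R]_(n + m)} := mulmxr (row_mx 0 1%:M).
rewrite (_ : (fun t => _) = (fun t => L (f t) + K (g t))).
  apply: cvgD.
    exact: (@continuous_comp _ _ _ f L t cf (@continuous_lin1 _ _ L (f t))).
  exact: (@continuous_comp _ _ _ g K t cg (@continuous_lin1 _ _ K (g t))).
apply/funext => u; rewrite /L /K /= !mul_mx_row !mulmx0 !mulmx1.
by rewrite add_row_mx addr0 add0r.
Qed.

Section chart.
Variables (S T : topologicalType) (n m : nat).
Variables (c : chart R S n) (d : chart R T m).

Let dom : set (S * T) := chart_dom c `*` chart_dom d.
Let cod : set 'rV[R]_(n + m) :=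
  [set x | chart_cod c (lsubmx x) /\ chart_cod d (rsubmx x)].
Let fwd (p : S * T) : 'rV[R]_(n + m) := row_mx (c p.1) (d p.2).
Let bwd (x : 'rV[R]_(n + m)) : S * T :=
  (chart_inv c (lsubmx x), chart_inv d (rsubmx x)).

Lemma prod_chart_dom_open : open dom.
Proof.
rewrite openE => -[p q] [/= pc qd]; exists (chart_dom c, chart_dom d) => //.
by split; apply: open_nbhs_nbhs; split=> //; exact: chart_dom_open.
Qed.

Lemma prod_chart_cod_open : open cod.
Proof.
apply: openI; apply: open_comp; try exact: chart_cod_open; move=> x _.
  exact: continuous_lsubmx.
exact: continuous_rsubmx.
Qed.

Lemma prod_chart_funP p : dom p -> cod (fwd p).
Proof.
by case=> ? ?; rewrite /cod /fwd/= row_mxKl row_mxKr; split; exact: chart_funP.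
Qed.

Lemma prod_chart_invP x : cod x -> dom (bwd x).
Proof. by case=> ? ?; split; exact: chart_invP. Qed.

Lemma prod_chart_funK p : dom p -> bwd (fwd p) = p.
Proof.
by case: p => p q [? ?]; rewrite /bwd /fwd/= row_mxKl row_mxKr !chart_funK.
Qed.

Lemma prod_chart_invK x : cod x -> fwd (bwd x) = x.
Proof. by case=> ? ?; rewrite /fwd/= !chart_invK// hsubmxK. Qed.

Lemma prod_chart_fun_continuous p : dom p -> {for p, continuous fwd}.
Proof.
case: p => p q [/= pc qd].
apply: continuous_row_mx; apply: continuous_comp.
- exact: cvg_fst.
- exact: chart_fun_continuous.
- exact: cvg_snd.
- exact: chart_fun_continuous.
Qed.

Lemma prod_chart_inv_continuous x : cod x -> {for x, continuous bwd}.
Proof.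
case=> xc xd.
have cl : {for x, continuous (chart_inv c \o lsubmx)}.
  by apply: continuous_comp; [exact: continuous_lsubmx|exact: chart_inv_continuous].
have cr : {for x, continuous (chart_inv d \o rsubmx)}.
  by apply: continuous_comp; [exact: continuous_rsubmx|exact: chart_inv_continuous].
exact: cvg_pair cl cr.
Qed.

Definition prod_chart : chart R (S * T)%type (n + m) :=
  Chart prod_chart_dom_open prod_chart_cod_open
    prod_chart_funP prod_chart_invP prod_chart_funK prod_chart_invK
    prod_chart_fun_continuous prod_chart_inv_continuous.
End chart.

Lemma prod_hausdorff (S T : topologicalType) :
  hausdorff_space S -> hausdorff_space T -> hausdorff_space (S * T)%type.
Proof.
move=> hS hT -[p q] [p' q'] cl; congr pair; [apply: hS|apply: hT] => A B.
  move=> Ap Bp; have [||[x y] [[/= Ax _] [/= Bx _]]] := cl (A `*` setT) (B `*` setT).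
  - by exists (A, setT) => //; split => //; exact: filterT.
  - by exists (B, setT) => //; split => //; exact: filterT.
  - by exists x.
move=> Ap Bp; have [||[x y] [[/= _ Ax] [/= _ Bx]]] := cl (setT `*` A) (setT `*` B).
- by exists (setT, A) => //; split => //; exact: filterT.
- by exists (setT, B) => //; split => //; exact: filterT.
- by exists y.
Qed.

Lemma prod_second_countable (S T : topologicalType) :
  @second_countable S -> @second_countable T -> @second_countable (S * T)%type.
Proof.
move=> [B cB [Bo Bb]] [C cC [Co Cb]].
exists ((fun p => p.1 `*` p.2) @` (B `*` C)).
  by apply: sub_countable (card_image_le _ _) _; exact: countableX.
split.
  move=> _ [[U V] [/= /Bo oU /Co oV] <-].
  rewrite openE => -[p q] [/= pc qd]; exists (U, V) => //.
  by split; apply: open_nbhs_nbhs.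
move=> [p q] A [[U V] [/= pU qV] UVA].
have [U' [BU' U'p] sU] := Bb p U pU.
have [V' [CV' V'q] sV] := Cb q V qV.
exists (U' `*` V').
  by split => //; exists (U', V').
by move=> [x y] [/= /sU ? /sV ?]; apply: UVA.
Qed.

Lemma smooth_on_lsubmx n m (U : set 'rV[R]_n) (f : 'rV[R]_n -> R) :
  open U -> smooth_on U f ->
  smooth_on (lsubmx @^-1` U) (fun x : 'rV[R]_(n + m) => f (lsubmx x)).
Proof.
move=> oU sf k; apply: (@Ck_on_comp _ _ _ _ _ lsubmx f).
- by apply: open_comp => // x _; exact: continuous_lsubmx.
- move=> j x _; rewrite (_ : (fun _ => _) = fun y : 'rV[R]_(n + m) => y 0 (lshift m j)).
    exact: Ck_coord.
  by apply/funext => y; rewrite mxE.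
- by move=> x; exact: sf.
Qed.

Lemma smooth_on_rsubmx n m (U : set 'rV[R]_m) (f : 'rV[R]_m -> R) :
  open U -> smooth_on U f ->
  smooth_on (rsubmx @^-1` U) (fun x : 'rV[R]_(n + m) => f (rsubmx x)).
Proof.
move=> oU sf k; apply: (@Ck_on_comp _ _ _ _ _ rsubmx f).
- by apply: open_comp => // x _; exact: continuous_rsubmx.
- move=> j x _; rewrite (_ : (fun _ => _) = fun y : 'rV[R]_(n + m) => y 0 (rshift n j)).
    exact: Ck_coord.
  by apply/funext => y; rewrite mxE.
- by move=> x; exact: sf.
Qed.

Lemma smooth_in_charts_open (T U : topologicalType) n m (c : chart R T n)
    (d : chart R U m) (F : T -> U) :
  continuous F ->
  open [set x | chart_cod c x /\ chart_dom d (F (chart_inv c x))].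
Proof.
move=> cF; rewrite openE => x [xc xd].
have := open_nbhs_nbhs (conj (@chart_cod_open _ _ _ c) xc).
have : \forall y \near x, chart_dom d (F (chart_inv c y)).
  apply: (continuous_comp (chart_inv_continuous xc) (cF _)).
  exact: open_nbhs_nbhs (conj (@chart_dom_open _ _ _ d) xd).
by apply: filterS2 => y.
Qed.

Variables M N : manifold R.

Definition prod_atlas : set (chart R (M * N)%type (manifold_dim M + manifold_dim N)) :=
  [set e | exists c d, [/\ atlas c, atlas d & e = prod_chart c d]].

Lemma prod_atlas_cover p : exists2 e, prod_atlas e & chart_dom e p.
Proof.
have [c ? ?] := atlas_cover p.1; have [d ? ?] := atlas_cover p.2.
by exists (prod_chart c d) => //; exists c, d.
Qed.

Lemma prod_atlas_compatible e e' :
  prod_atlas e -> prod_atlas e' -> smooth_in_charts e e' id.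
Proof.
move=> [c [d [ac ad ->]]] [c' [d' [ac' ad' ->]]] j k x [[/= xc xd] [/= xc' xd']].
rewrite -(splitK j); case: (fintype.split j) => i /=.
  rewrite (_ : (fun _ => _) = fun x : 'rV[R]_(manifold_dim M + manifold_dim N) =>
      (fun y => c' (chart_inv c y) 0 i) (lsubmx x)); last first.
    by apply/funext => y; rewrite row_mxEl.
  apply: (smooth_on_lsubmx _ (atlas_compatible ac ac' i)) => //.
  exact: (@smooth_in_charts_open _ _ _ _ c c' id (fun x => cvg_id)).
rewrite (_ : (fun _ => _) = fun x : 'rV[R]_(manifold_dim M + manifold_dim N) =>
    (fun y => d' (chart_inv d y) 0 i) (rsubmx x)); last first.
  by apply/funext => y; rewrite row_mxEr.
apply: (smooth_on_rsubmx _ (atlas_compatible ad ad' i)) => //.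
exact: (@smooth_in_charts_open _ _ _ _ d d' id (fun x => cvg_id)).
Qed.

Definition prod_manifold : manifold R :=
  @Manifold R (M * N)%type _ prod_atlas
    (prod_hausdorff (@manifold_hausdorff _ M) (@manifold_hausdorff _ N))
    (prod_second_countable (@manifold_second_countable _ M)
       (@manifold_second_countable _ N))
    prod_atlas_cover prod_atlas_compatible.

End product_manifold.

Section smooth_maps.
Context {R : realType}.

Lemma smooth_fun_comp (M N : manifold R) (F : M -> N) (f : N -> R) :
  is_smooth_map F -> is_smooth_fun f -> is_smooth_fun (f \o F).
Proof.
move=> [cF sF] sf c ac k x xc.
have [d ad dx] := atlas_cover (F (chart_inv c x)).
pose U := [set x | chart_cod c x /\ chart_dom d (F (chart_inv c x))].
have oU : open U by exact: smooth_in_charts_open.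
apply: (@eq_Ck_on _ _ _ U
    ((f \o chart_inv d) \o (fun y => d (F (chart_inv c y))))) => //.
  by move=> y /[1!inE] -[yc yd] /=; rewrite chart_funK.
apply: Ck_on_comp => //; first by move=> j; exact: sF.
by move=> y [yc yd]; apply: sf => //; exact: chart_funP.
Qed.

Lemma pair_left_smooth (M N : manifold R) (q : N) :
  @is_smooth_map R M (prod_manifold M N) (fun p => (p, q)).
Proof.
split=> [p|c _ ac [d [e [ad ae ->]]] j k x [xc [/= xd qe]]].
  by apply: cvg_pair; [exact: cvg_id|exact: cvg_cst].
rewrite -(splitK j); case: (fintype.split j) => i /=.
  under eq_fun do rewrite row_mxEl.
  exact: (atlas_compatible ac ad).
under eq_fun do rewrite row_mxEr.
exact: Ck_cst.
Qed.

Lemma pair_right_smooth (M N : manifold R) (p : M) :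
  @is_smooth_map R N (prod_manifold M N) (fun q => (p, q)).
Proof.
split=> [q|c _ ac [d [e [ad ae ->]]] j k x [xc [/= pd xe]]].
  by apply: cvg_pair; [exact: cvg_cst|exact: cvg_id].
rewrite -(splitK j); case: (fintype.split j) => i /=.
  under eq_fun do rewrite row_mxEl.
  exact: Ck_cst.
under eq_fun do rewrite row_mxEr.
exact: (atlas_compatible ac ae).
Qed.

Definition pair_left (M N : manifold R) (q : N) : smooth_map M (prod_manifold M N) :=
  SmoothMap (@pair_left_smooth M N q).

Definition pair_right (M N : manifold R) (p : M) : smooth_map N (prod_manifold M N) :=
  SmoothMap (@pair_right_smooth M N p).

End smooth_maps.

Section smooth_functions.
Context {R : realType} (M : manifold R).

Lemma smooth_fun_cst (a : R) : is_smooth_fun (cst a : M -> R).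
Proof. by move=> c _ k x _; exact: Ck_cst. Qed.

Lemma smooth_funD (f g : M -> R) :
  is_smooth_fun f -> is_smooth_fun g -> is_smooth_fun (f + g).
Proof.
move=> sf sg c ac k; apply: (@Ck_onD _ _ _ _ (f \o chart_inv c) (g \o chart_inv c)).
- exact: chart_cod_open.
- exact: sf.
- exact: sg.
Qed.

Lemma smooth_funM (f g : M -> R) :
  is_smooth_fun f -> is_smooth_fun g -> is_smooth_fun (f * g).
Proof.
move=> sf sg c ac k; apply: (@Ck_onM _ _ _ _ (f \o chart_inv c) (g \o chart_inv c)).
- exact: chart_cod_open.
- exact: sf.
- exact: sg.
Qed.

Definition smooth_funs : {pred M -> R} := fun f => `[< is_smooth_fun f >].

Lemma smooth_funs_submod : submod_closed smooth_funs.
Proof.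
split=> [|a f g /asboolP sf /asboolP sg]; first exact/asboolP/smooth_fun_cst.
apply/asboolP; apply: smooth_funD => //.
by rewrite (_ : a *: f = cst a * f) //; apply: smooth_funM => //; exact: smooth_fun_cst.
Qed.

Lemma smooth_funs_subring : subring_closed smooth_funs.
Proof.
split=> [|f g sf sg|f g /asboolP sf /asboolP sg].
- exact/asboolP/smooth_fun_cst.
- by rewrite addrC -scaleN1r; exact: (smooth_funs_submod.2).
- exact/asboolP/smooth_funM.
Qed.

Record Cinf := MkCinf { Cinf_fun :> M -> R; _ : Cinf_fun \in smooth_funs }.

HB.instance Definition _ := [isSub for Cinf_fun].
HB.instance Definition _ := [Choice of Cinf by <:].
HB.instance Definition _ := GRing.isSubringClosed.Build (M -> R) smooth_funs smooth_funs_subring.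
HB.instance Definition _ := GRing.isSubmodClosed.Build R (M -> R) smooth_funs smooth_funs_submod.
HB.instance Definition _ :=
  GRing.SubChoice_isSubComPzRing.Build _ _ Cinf (GRing.subringClosedP _).
HB.instance Definition _ := [SubZmodule_isSubLmodule of Cinf by <:].

Lemma CinfP (f : Cinf) : is_smooth_fun f.
Proof. by case: f => f sf; exact/asboolP. Qed.

Definition mkCinf (f : M -> R) (sf : is_smooth_fun f) : Cinf := MkCinf (asboolT sf).

Lemma Cinf_eqP (f g : Cinf) : f =1 g -> f = g.
Proof. by move=> fg; apply/val_inj/funext. Qed.

Lemma CinfDE (f g : Cinf) p : (f + g) p = f p + g p. Proof. by []. Qed.
Lemma CinfNE (f : Cinf) p : (- f) p = - f p. Proof. by []. Qed.
Lemma CinfME (f g : Cinf) p : (f * g) p = f p * g p. Proof. by []. Qed.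
Lemma CinfZE (a : R) (f : Cinf) p : (a *: f) p = a * f p. Proof. by []. Qed.
Lemma Cinf0E p : (0 : Cinf) p = 0. Proof. by []. Qed.
Lemma Cinf1E p : (1 : Cinf) p = 1. Proof. by []. Qed.
Definition CinfE := (CinfDE, CinfNE, CinfME, CinfZE, Cinf0E, Cinf1E).

Lemma CinfZl (a : R) (f g : Cinf) : (a *: f) * g = a *: (f * g).
Proof. by apply: Cinf_eqP => p; rewrite !CinfE mulrA. Qed.

Lemma CinfZr (a : R) (f g : Cinf) : f * (a *: g) = a *: (f * g).
Proof. by rewrite mulrC CinfZl mulrC. Qed.

End smooth_functions.

Definition pullback (R : realType) (M N : manifold R) (F : smooth_map M N)
    (f : Cinf N) : Cinf M :=
  mkCinf (smooth_fun_comp (smooth_mapP F) (CinfP f)).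

(* Tensor fields are treated as modules over the algebra C^oo(M): vector fields
   are the derivations of C^oo(M), 1-forms are the C^oo(M)-linear maps from vector
   fields to C^oo(M), and bivector fields are the C^oo(M)-bilinear skew-symmetric
   maps from pairs of 1-forms to C^oo(M). On a Hausdorff second countable manifold
   these are the smooth sections of TM, T^*M and of the second exterior power of
   TM. *)
Section vector_fields.
Context {R : realType} (M : manifold R).
Local Notation C := (Cinf M).

Definition is_derivation (X : C -> C) :=
  (forall (a : R) f g, X (a *: f + g) = a *: X f + X g) /\
  (forall f g, X (f * g) = f * X g + g * X f).

Definition derivations : {pred C -> C^o} := fun X => `[< is_derivation X >].

Lemma derivations_submod : submod_closed derivations.
Proof.
split=> [|a X Y /asboolP[Xl Xm] /asboolP[Yl Ym]]; apply/asboolP; split.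
- by move=> a f g; apply: Cinf_eqP => p; rewrite !CinfE /=; ring.
- by move=> f g; apply: Cinf_eqP => p; rewrite !CinfE /=; ring.
- move=> b f g; have E h : (a *: X + Y) h = a * X h + Y h by [].
  by apply: Cinf_eqP => p; rewrite !E Xl Yl !CinfE /=; ring.
- move=> f g; have E h : (a *: X + Y) h = a * X h + Y h by [].
  by apply: Cinf_eqP => p; rewrite !E Xm Ym !CinfE /=; ring.
Qed.

Record vfield := MkVfield {
  vfield_val : C -> C^o;
  _ : vfield_val \in derivations
}.

HB.instance Definition _ := [isSub for vfield_val].
HB.instance Definition _ := [Choice of vfield by <:].
HB.instance Definition _ :=
  GRing.isSubmodClosed.Build C (C -> C^o) derivations derivations_submod.
HB.instance Definition _ := [SubChoice_isSubLmodule of vfield by <:].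

Definition vfield_fun (X : vfield) : C -> C := vfield_val X.
Coercion vfield_fun : vfield >-> Funclass.

Lemma vfieldP (X : vfield) : is_derivation X.
Proof. by case: X => X dX; exact/asboolP. Qed.

Definition mkVfield (X : C -> C) (dX : is_derivation X) : vfield :=
  MkVfield (asboolT dX : (X : C -> C^o) \in derivations).

Lemma vfield_eqP (X Y : vfield) : X =1 Y -> X = Y.
Proof. by move=> XY; apply/val_inj/funext. Qed.

Lemma vfieldDE (X Y : vfield) f : (X + Y) f = X f + Y f. Proof. by []. Qed.
Lemma vfieldZE (a : C) (X : vfield) f : (a *: X) f = a * X f. Proof. by []. Qed.

Lemma vfieldM (X : vfield) f g : X (f * g) = f * X g + g * X f.
Proof. exact: (vfieldP X).2. Qed.
Lemma vfieldD (X : vfield) f g : X (f + g) = X f + X g.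
Proof. by have := (vfieldP X).1 1 f g; rewrite !scale1r. Qed.
Lemma vfieldB (X : vfield) f g : X (f - g) = X f - X g.
Proof.
by have := (vfieldP X).1 (-1) g f; rewrite !scaleN1r [- g + f]addrC [- X g + _]addrC.
Qed.
Lemma vfieldL (X : vfield) (a : R) f g : X (a *: f + g) = a *: X f + X g.
Proof. exact: (vfieldP X).1. Qed.

Lemma vbracket_subproof (X Y : vfield) :
  is_derivation (fun f => X (Y f) - Y (X f)).
Proof.
split=> [a f g|f g]; apply: Cinf_eqP => p.
  by rewrite !vfieldL !CinfE; ring.
by rewrite !vfieldM !vfieldD !vfieldM !CinfE; ring.
Qed.

Definition vbracket (X Y : vfield) : vfield := mkVfield (vbracket_subproof X Y).

Lemma vbracketE X Y f : vbracket X Y f = X (Y f) - Y (X f).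
Proof. by []. Qed.

Definition is_one_form (al : vfield -> C) :=
  forall (a : C) X Y, al (a *: X + Y) = a * al X + al Y.

Definition one_forms : {pred vfield -> C^o} := fun al => `[< is_one_form al >].

Lemma one_forms_submod : submod_closed one_forms.
Proof.
split=> [|a al be /asboolP lal /asboolP lbe]; apply/asboolP => b X Y.
  by rewrite /= mulr0 addr0.
have E Z : (a *: al + be) Z = a * al Z + be Z by [].
by apply: Cinf_eqP => p; rewrite !E lal lbe !CinfE /=; ring.
Qed.

Record one_form := MkOne_form {
  one_form_val : vfield -> C^o;
  _ : one_form_val \in one_forms
}.

HB.instance Definition _ := [isSub for one_form_val].
HB.instance Definition _ := [Choice of one_form by <:].
HB.instance Definition _ :=
  GRing.isSubmodClosed.Build C (vfield -> C^o) one_forms one_forms_submod.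
HB.instance Definition _ := [SubChoice_isSubLmodule of one_form by <:].

Definition one_form_fun (al : one_form) : vfield -> C := one_form_val al.
Coercion one_form_fun : one_form >-> Funclass.

Lemma one_formP (al : one_form) : is_one_form al.
Proof. by case: al => al lal; exact/asboolP. Qed.

Definition mkOne_form (al : vfield -> C) (lal : is_one_form al) : one_form :=
  MkOne_form (asboolT lal : (al : vfield -> C^o) \in one_forms).

Lemma one_form_eqP (al be : one_form) : al =1 be -> al = be.
Proof. by move=> ab; apply/val_inj/funext. Qed.

Lemma one_formD (al : one_form) X Y : al (X + Y) = al X + al Y.
Proof. by have := one_formP al 1 X Y; rewrite scale1r mul1r. Qed.
Lemma one_formZ (al : one_form) a X : al (a *: X) = a * al X.
Proof.
have al0 : al 0 = 0.
  by apply: (addrI (al 0)); rewrite -one_formD !addr0.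
by have := one_formP al a X 0; rewrite !addr0 al0 addr0.
Qed.

Lemma dfun_subproof (f : C) : is_one_form (fun X => X f).
Proof. by []. Qed.

Definition dfun (f : C) : one_form := mkOne_form (dfun_subproof f).

(* exterior derivative of a 1-form, evaluated on a pair of vector fields *)
Definition dform (al : one_form) (X Y : vfield) : C :=
  X (al Y) - Y (al X) - al (vbracket X Y).

Definition wedge (al be : one_form) (X Y : vfield) : C :=
  al X * be Y - al Y * be X.

Lemma lie_form_subproof (X : vfield) (al : one_form) :
  is_one_form (fun Y => X (al Y) - al (vbracket X Y)).
Proof.
move=> a Y Z.
have -> : vbracket X (a *: Y + Z) = a *: vbracket X Y + (X a *: Y + vbracket X Z).
  apply: vfield_eqP => f; rewrite !(vfieldDE, vfieldZE, vbracketE).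
  rewrite vfieldD vfieldM.
  by apply: Cinf_eqP => p; rewrite !CinfE; ring.
rewrite !one_formD !one_formZ vfieldD vfieldM.
by apply: Cinf_eqP => p; rewrite !CinfE; ring.
Qed.

Definition lie_form (X : vfield) (al : one_form) : one_form :=
  mkOne_form (@lie_form_subproof X al).

Lemma dfunL (a : R) f g : dfun (a *: f + g) = (a *: (1 : C)) *: dfun f + dfun g.
Proof.
apply: one_form_eqP => X; rewrite [LHS]vfieldL.
by apply: Cinf_eqP => p; rewrite !CinfE /=; ring.
Qed.

Lemma dfunM f g : dfun (f * g) = f *: dfun g + g *: dfun f.
Proof. by apply: one_form_eqP => X; exact: vfieldM. Qed.

End vector_fields.

Section poisson.
Context {R : realType}.

Record poisson_structure (M : manifold R) := PoissonStructure {
  bivector :> one_form M -> one_form M -> Cinf M;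
  bivector_linear : forall a al be ga,
    bivector (a *: al + be) ga = a * bivector al ga + bivector be ga;
  bivector_skew : forall al be, bivector al be = - bivector be al;
  bivector_jacobi : forall f g h : Cinf M,
    let br f g := bivector (dfun f) (dfun g) in
    br f (br g h) + br g (br h f) + br h (br f g) = 0
}.

Definition bracket (M : manifold R) (pi : poisson_structure M) (f g : Cinf M) : Cinf M :=
  pi (dfun f) (dfun g).

Section sharp.
Variables (M : manifold R) (pi : poisson_structure M).

Lemma bivector_linearr a al be ga :
  pi al (a *: be + ga) = a * pi al be + pi al ga.
Proof.
by rewrite bivector_skew bivector_linear opprD -mulrN -!(bivector_skew _ al).
Qed.

Lemma bivectorZr a al be : pi al (a *: be) = a * pi al be.
Proof.
have pi0 : pi al 0 = 0.
  apply: (addrI (pi al 0)); have := bivector_linearr 1 al 0 0.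
  by rewrite scale1r mul1r !addr0.
by have := bivector_linearr a al be 0; rewrite !addr0 pi0 addr0.
Qed.

Lemma sharp_subproof al : is_derivation (fun f => pi al (dfun f)).
Proof.
split=> [a f g|f g].
  rewrite dfunL bivector_linearr; congr (_ + _).
  by apply: Cinf_eqP => p; rewrite !CinfE mulr1.
rewrite dfunM bivector_linearr; congr (_ + _).
exact: bivectorZr.
Qed.

Definition sharp al : vfield M := mkVfield (sharp_subproof al).

(* [[al, be]_pi = L_{pi^# al} be - L_{pi^# be} al - d (pi (al, be))] *)
Definition form_bracket al be : one_form M :=
  lie_form (sharp al) be - lie_form (sharp be) al - dfun (pi al be).

(* Lie derivative of the bivector field along [X], evaluated on 1-forms *)
Definition lie_bivector (X : vfield M) al be : Cinf M :=
  X (pi al be) - pi (lie_form X al) be - pi al (lie_form X be).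
End sharp.

(* bracket of the product bivector field piM (+) piN, slice by slice:
   {f, g}(x, y) = {f(., y), g(., y)}_M (x) + {f(x, .), g(x, .)}_N (y) *)
Definition prod_bracket (M N : manifold R) (piM : poisson_structure M)
    (piN : poisson_structure N) (f g : Cinf (prod_manifold M N)) (p : M * N) : R :=
  bracket piM (pullback (pair_left M p.2) f) (pullback (pair_left M p.2) g) p.1 +
  bracket piN (pullback (pair_right N p.1) f) (pullback (pair_right N p.1) g) p.2.

(* [br] is the Poisson bracket of the source; it is a parameter so that the
   source can be a product, through [prod_bracket]. *)
Definition is_poisson_map (M N : manifold R) (br : Cinf M -> Cinf M -> M -> R)
    (pi : poisson_structure N) (F : smooth_map M N) :=
  forall f g p, br (pullback F f) (pullback F g) p = bracket pi f g (F p).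

End poisson.

Section tangent.
Context {R : realType} (M : manifold R) (p : M).
Local Notation C := (Cinf M).

Definition is_tangent (v : C -> R) :=
  (forall (a : R) f g, v (a *: f + g) = a * v f + v g) /\
  (forall f g, v (f * g) = f p * v g + g p * v f).

Definition tangents : {pred C -> R^o} := fun v => `[< is_tangent v >].

Lemma tangents_submod : submod_closed tangents.
Proof.
split=> [|a v w /asboolP[vl vm] /asboolP[wl wm]]; apply/asboolP; split.
- by move=> a f g; rewrite /= mulr0 addr0.
- by move=> f g; rewrite /= !mulr0 addr0.
- move=> b f g; have E h : (a *: v + w) h = a * v h + w h by [].
  by rewrite !E vl wl; ring.
- move=> f g; have E h : (a *: v + w) h = a * v h + w h by [].
  by rewrite !E vm wm; ring.
Qed.

Record tangent := MkTangent {
  tangent_val : C -> R^o;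
  _ : tangent_val \in tangents
}.

HB.instance Definition _ := [isSub for tangent_val].
HB.instance Definition _ := [Choice of tangent by <:].
HB.instance Definition _ :=
  GRing.isSubmodClosed.Build R (C -> R^o) tangents tangents_submod.
HB.instance Definition _ := [SubChoice_isSubLmodule of tangent by <:].

Definition tangent_fun (v : tangent) : C -> R := tangent_val v.
Coercion tangent_fun : tangent >-> Funclass.

Lemma vfield_at_subproof (X : vfield M) : is_tangent (fun f => X f p).
Proof. by split=> [a f g|f g]; rewrite ?vfieldL ?vfieldM. Qed.

Definition vfield_at (X : vfield M) : tangent :=
  MkTangent (asboolT (vfield_at_subproof X) :
    ((fun f => X f p) : C -> R^o) \in tangents).

End tangent.

Section lie_group.
Context {R : realType}.

Record lie_group := LieGroup {
  lie_group_manifold :> manifold R;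
  lie_mul : smooth_map (prod_manifold lie_group_manifold lie_group_manifold)
              lie_group_manifold;
  lie_inv : smooth_map lie_group_manifold lie_group_manifold;
  lie_one : lie_group_manifold;
  lie_mulA : forall x y z, lie_mul (x, lie_mul (y, z)) = lie_mul (lie_mul (x, y), z);
  lie_mul1 : forall x, lie_mul (lie_one, x) = x;
  lie_mulV : forall x, lie_mul (lie_inv x, x) = lie_one
}.

Variable G : lie_group.

(* The underlying vector space of the Lie algebra is T_e G. *)
Definition lie_algebra := tangent (lie_one G).

(* h |-> f (h g) *)
Definition right_translate (g : G) (f : Cinf G) : Cinf G :=
  pullback (pair_left G g) (pullback (lie_mul G) f).

Definition right_invariant (X : vfield G) :=
  forall g f, X (right_translate g f) = right_translate g (X f).

(* [zeta = [xi, eta]], for the bracket of right-invariant vector fields *)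
Definition is_lie_bracket (xi eta zeta : lie_algebra) :=
  exists X Y : vfield G,
    [/\ right_invariant X /\ right_invariant Y,
        vfield_at (lie_one G) X = xi,
        vfield_at (lie_one G) Y = eta &
        vfield_at (lie_one G) (vbracket X Y) = zeta].

Definition smooth_curve (c : R -> G) :=
  continuous c /\
  forall (f : Cinf G) n t, derivable (derive1n n (f \o c)) t 1.

(* [c t = exp (t xi)] *)
Definition one_parameter_subgroup (xi : lie_algebra) (c : R -> G) :=
  [/\ smooth_curve c,
      forall s t, c (s + t) = lie_mul G (c s, c t) &
      forall f : Cinf G, is_derive (0 : R) 1 (f \o c) (xi f)].

(* A Poisson structure on [G] is multiplicative when the multiplication is a
   Poisson map from [G * G] with the product structure. *)
Definition multiplicative (piG : poisson_structure G) :=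
  is_poisson_map (prod_bracket piG piG) piG (lie_mul G).

(* [w] stands for the element sum_(ab <- w) ab.1 /\ ab.2 of the second exterior
   power of the Lie algebra; the predicate says that it is
   delta(xi) = (L_X piG)(e), where X is a vector field with X(e) = xi (the choice
   of X is irrelevant because piG vanishes at e). Bivectors at e are compared on
   pairs of differentials of smooth functions. *)
Definition is_cobracket (piG : poisson_structure G) (xi : lie_algebra)
    (w : seq (lie_algebra * lie_algebra)) :=
  exists2 X : vfield G, vfield_at (lie_one G) X = xi &
    forall f g : Cinf G,
      lie_bivector piG X (dfun f) (dfun g) (lie_one G) =
      \sum_(ab <- w) (ab.1 f * ab.2 g - ab.1 g * ab.2 f).

Section action.
Variable M : manifold R.

Definition is_action (Phi : smooth_map (prod_manifold G M) M) :=
  (forall m, Phi (lie_one G, m) = m) /\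
  (forall g h m, Phi (lie_mul G (g, h), m) = Phi (g, Phi (h, m))).

(* [X = varphi(xi)], that is X(m) = d/dt|_(t = 0) Phi (exp (t xi), m) *)
Definition infinitesimal_generator (Phi : smooth_map (prod_manifold G M) M)
    (xi : lie_algebra) (X : vfield M) :=
  exists2 c, one_parameter_subgroup xi c &
    forall (f : Cinf M) m,
      is_derive (0 : R) 1 (fun t => f (Phi (c t, m))) (X f m).

(* (phi /\ phi)(w), for [w] as in [is_cobracket] *)
Definition wedge_image (phi : lie_algebra -> one_form M)
    (w : seq (lie_algebra * lie_algebra)) (X Y : vfield M) : Cinf M :=
  \sum_(ab <- w) wedge (phi ab.1) (phi ab.2) X Y.

Record infinitesimal_momentum_map (piG : poisson_structure G)
    (pi : poisson_structure M) (Phi : smooth_map (prod_manifold G M) M)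
    (phi : lie_algebra -> one_form M) : Prop := InfinitesimalMomentumMap {
  (* R-linearity; real numbers act on 1-forms as constant functions *)
  momentum_linear : forall (a : R) xi eta,
    phi (a *: xi + eta) = (a *: (1 : Cinf M)) *: phi xi + phi eta;
  momentum_bracket : forall xi eta zeta, is_lie_bracket xi eta zeta ->
    phi zeta = form_bracket pi (phi xi) (phi eta);
  momentum_cobracket : forall xi w, is_cobracket piG xi w ->
    forall X Y, dform (phi xi) X Y = wedge_image phi w X Y;
  momentum_generator : forall xi,
    infinitesimal_generator Phi xi (sharp pi (phi xi))
}.

End action.
End lie_group.

Section simply_connected.
Context {R : realType}.

(* Every loop is null-homotopic relative to its base point; connectedness is a
   separate hypothesis. *)
Definition simply_connected (T : topologicalType) :=
  forall gamma : R -> T,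
    {within `[0, 1], continuous gamma} -> gamma 0 = gamma 1 ->
    exists H : R * R -> T,
      [/\ {within `[0, 1] `*` `[0, 1], continuous H},
          forall t, t \in `[0, 1] -> H (t, 0) = gamma t /\ H (t, 1) = gamma 0 &
          forall s, s \in `[0, 1] -> H (0, s) = gamma 0 /\ H (1, s) = gamma 0].

End simply_connected.

Arguments lie_group R : clear implicits.
Arguments simply_connected R T : clear implicits.

(* Main.v *)
Require Import Defs.
From mathcomp Require Import all_boot all_order all_algebra.
From mathcomp Require Import boolp classical_sets functions reals topology normedtype derive.
From mathcomp Require Import ereal landau sequences realfun exp.
From mathcomp Require Import measure lebesgue_measure lebesgue_integral ftc.
From mathcomp Require Import ring lra.
Import Order.TTheory GRing.Theory Num.Theory.
Import numFieldNormedType.Exports.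
(* Loading the ring theory rebinds the name multiplicative; this restores the
   one for Poisson structures. *)
Import Defs.

Set Implicit Arguments.
Unset Strict Implicit.
Unset Printing Implicit Defensive.

Local Open Scope classical_set_scope.
Local Open Scope ring_scope.

(** Write [a m] for [Phi (a, m)]. For smooth [f], [g] on M and a point [m], put
    [u(y) = f(y m)], [v(y) = g(y m)] on G and consider the function on G
<<
      D(b) = {u(b^-1 .), v(b^-1 .)}_G (b) + {f, g}_M (m)
             - {f(b^-1 .), g(b^-1 .)}_M (b m),
>>
    called [defect] below. It is the failure of Phi to be Poisson at [(b, m)],
    for the functions [f(b^-1 .)] and [g(b^-1 .)]; so it is enough to prove that
    all these functions vanish.

    Multiplicativity of the Poisson structure of G makes the defect a cocycle
    ([defect_cocycle]): right translates of defects are again defects, up to an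
    additive constant. The derivative of a defect in any direction at any point
    of G is therefore the derivative of some defect in a direction [xi] at the
    unit. That one is computed with the Leibniz rule: as the Poisson structure of
    G vanishes at the unit, it equals
<<
      xi {u, v}_G - (L_X pi)(df, dg)(m),    X = pi^#(phi_xi).
>>
    The first term is the cobracket of [xi] evaluated on [u] and [v]
    ([exists_cobracket]). The Jacobi identity gives [L_X pi = d(phi_xi)] on
    Hamiltonian vector fields ([lie_bivector_sharp]), and the momentum map
    condition on [d(phi_xi)] says that both terms agree
    ([infinitesimal_poisson_action]). Hence a defect has zero derivative
    everywhere, and it vanishes at the unit; since G is connected it is zero
    ([defect0]).

    The rest of the development serves to make this computation meaningful, since
    vector fields, forms and bivectors are given algebraically, by their action
    on smooth functions. What makes tangent vectors depend on first derivatives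
    only is Hadamard's lemma ([hadamard]), obtained by integrating the partial
    derivatives of a function along rays; smooth bump functions localize it. The
    outcome is that every point has a neighbourhood with coordinate functions and
    coordinate vector fields, globally defined and smooth, in which every tangent
    vector can be expanded ([exists_frame]). From it follow that brackets of
    families of functions depend smoothly on parameters ([slice_bracket_smooth])
    and that a parameter derivative commutes with a tangent vector
    ([derive_slices_comm]), which is the symmetry of second derivatives. *)

(** * Smooth bump functions *)

Section flat_functions.
Context {R : realType}.

(** The family is closed under differentiation up to linear combinations, and so
    all its members are shown to be smooth in one induction. *)
Definition flat (n : nat) (x : R) : R :=
  if 0 < x then x^-1 ^+ n * expR (- x^-1) else 0.

Lemma flat_le0 n x : x <= 0 -> flat n x = 0.
Proof. by rewrite /flat leNgt => /negbTE ->. Qed.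

Lemma flat_gt0 n x : 0 < x -> 0 < flat n x.
Proof.
by move=> x0; rewrite /flat x0 mulr_gt0 ?expR_gt0 // exprn_gt0 // invr_gt0.
Qed.

Lemma flat_ge0 n x : 0 <= flat n x.
Proof.
have [/flat_le0 ->//|x0] := leP x 0; exact/ltW/flat_gt0.
Qed.

Lemma flatS n x : flat n x = x * flat n.+1 x.
Proof.
rewrite /flat; case: ifPn => x0; last by rewrite mulr0.
by rewrite exprS mulrA mulrA mulfV ?gt_eqF // mul1r.
Qed.

Lemma flat_le n x : flat n x <= (n`!)%:R.
Proof.
have [x0|x0] := leP x 0; first by rewrite flat_le0.
rewrite /flat x0 expRN ler_pdivrMr ?expR_gt0 //.
have y0 : 0 <= x^-1 by rewrite invr_ge0 ltW.
case: n => [|n].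
  by rewrite expr0 fact0 mul1r -expR0 ler_expR.
have := expR_ge1Dxn n y0 => h.
rewrite mulrC -ler_pdivrMr ?ltr0n ?fact_gt0 //.
by apply: le_trans h; rewrite lerDr.
Qed.

(** Two powers of [x] are gained from [flat n x = x * flat n.+1 x]; this quadratic
    bound is what makes the derivative at 0 exist and vanish. *)
Lemma flat_norm_le n x : `|flat n x| <= n.+2`!%:R * `|x| ^+ 2.
Proof.
rewrite (flatS n) (flatS n.+1) mulrA normrM -expr2 normrX mulrC.
rewrite ler_wpM2r ?exprn_ge0 // ger0_norm ?flat_ge0 //.
exact: flat_le.
Qed.

Lemma is_derive_flat n (x : R) :
  is_derive x 1 (flat n) (flat n.+2 x - n%:R * flat n.+1 x).
Proof.
have [x0|x0|->] := ltgtP x 0.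
- rewrite !flat_le0 ?(ltW x0) // mulr0 subr0.
  apply: (@near_eq_is_derive _ _ _ (cst 0) _ x 1).
  near=> y; rewrite flat_le0 //; apply: ltW; near: y.
  exact: lt_nbhsl.
- pose f (y : R) := y^-1 ^+ n * expR (- y^-1).
  have fE : \forall y \near x, f y = flat n y.
    near=> y; rewrite /flat ifT //; near: y; exact: lt_nbhsr.
  apply: (near_eq_is_derive fE).
  have xn : x != 0 by rewrite gt_eqF.
  have dV : is_derive x (1 : R) (fun y : R => y^-1) (- x ^- 2).
    have := @is_deriveV _ id x 1 1 xn _.
    by rewrite /GRing.scale /= mulr1; apply.
  have dN : is_derive x (1 : R) (fun y : R => - y^-1) (x ^- 2).
    by rewrite -[x ^- 2]opprK; exact: is_deriveN.
  have dE : is_derive x (1 : R) (fun y : R => expR (- y^-1))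
      (expR (- x^-1) * x ^- 2).
    exact: (@is_derive1_comp _ expR (fun y : R => - y^-1)).
  have dX : is_derive x (1 : R) (fun y : R => y^-1 ^+ n)
      (n%:R * x^-1 ^+ n.-1 * (- x ^- 2)).
    rewrite (_ : (fun y : R => y^-1 ^+ n) = (fun y : R => y^-1) ^+ n) //.
      exact: is_deriveX.
    by apply/funext => y; rewrite exprfctE.
  apply: (@is_derive_eq _ _ _ _ _ _ _ _ (is_deriveM dX dE)).
  rewrite /flat x0 /GRing.scale /= -exprVn.
  by case: n {f fE dX} => [|n] /=; rewrite ?mul0r !exprS; ring.
- rewrite !flat_le0 // mulr0 subr0.
  have cv : (fun h : R => h^-1 *: (flat n (h *: 1 + 0) - flat n 0)) @ 0^' --> (0 : R).
    apply/cvgr0Pnorm_le => e e0; near=> h.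
    have h0 : h != 0 by near: h; exact: nbhs_dnbhs_neq.
    rewrite [h *: 1]mulr1 addr0 [flat n 0]flat_le0 // subr0 normrZ.
    have C0 : 0 < n.+2`!%:R :> R by rewrite ltr0n fact_gt0.
    apply: le_trans (_ : `|h^-1| * (n.+2`!%:R * `|h| ^+ 2) <= _).
      by rewrite ler_wpM2l // flat_norm_le.
    rewrite normfV mulrCA expr2 mulKf ?normr_eq0 // -ler_pdivlMl //.
    by near: h; apply: dnbhs0_le; rewrite mulrC divr_gt0 // ltr0n fact_gt0.
  apply: DeriveDef.
    by apply/cvg_ex; exists 0; exact: cv.
  exact: cvg_lim cv.
Unshelve. all: by end_near.
Qed.

Lemma flat_differentiable n (x : R) : differentiable (flat n) x.
Proof. by apply/derivable1_diffP; case: (is_derive_flat n x). Qed.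

Lemma derive_comp_real (V : normedModType R) (g : R -> R) (f : V -> R) x v a :
  is_derive (f x) 1 g a -> differentiable f x ->
  'D_v (g \o f) x = a * 'D_v f x.
Proof.
move=> [dg <-] df; have dg' : differentiable g (f x) by apply/derivable1_diffP.
rewrite !deriveE //; last exact: differentiable_comp.
rewrite diff_comp //=.
by rewrite -[X in 'd g _ X]mulr1 [in LHS]linearZ /= mulrC.
Qed.

Lemma Ck_on_flat m k n (U : set 'rV[R]_m) (f : 'rV[R]_m -> R) :
  open U -> Ck_on k U f -> Ck_on k U (flat n \o f).
Proof.
move=> oU; elim: k n => [|k IH] n Cf x Ux.
  apply: continuous_comp; first exact: Cf.
  exact/differentiable_continuous/flat_differentiable.
split.
  apply: differentiable_comp; [exact: (Cf x Ux).1|exact: flat_differentiable].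
move=> i; have Cf' : Ck_on k U f by move=> y Uy; apply/CkW/Cf.
apply: (@eq_Ck_on _ _ _ U ((flat n.+2 \o f + cst (- n%:R) * (flat n.+1 \o f)) *
  (fun y => 'D_(delta_mx 0 i) f y))) => //.
  move=> y /[1!inE] Uy.
  rewrite (derive_comp_real _ (is_derive_flat n (f y)) (Cf y Uy).1).
  by rewrite /= -mulNr.
apply: Ck_onM => //; last by move=> y Uy; exact: (Cf y Uy).2.
apply: Ck_onD => //; first exact: IH.
apply: Ck_onM => //; last exact: IH.
by move=> y _; exact: Ck_cst.
Qed.

Lemma Ck_onV m k (U : set 'rV[R]_m) (f : 'rV[R]_m -> R) :
  open U -> (forall x, U x -> f x != 0) -> Ck_on k U f ->
  Ck_on k U (fun x => (f x)^-1).
Proof.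
move=> oU f0; elim: k => [|k IH] Cf x Ux.
  by apply: continuousV; [exact: f0|exact: Cf].
split; first by apply: differentiableV; [exact: (Cf x Ux).1|exact: f0].
move=> i; have Cf' : Ck_on k U f by move=> y Uy; apply/CkW/Cf.
apply: (@eq_Ck_on _ _ _ U (cst (-1) * ((fun x => (f x)^-1) * (fun x => (f x)^-1)) *
  (fun y => 'D_(delta_mx 0 i) f y))) => //.
  move=> y /[1!inE] Uy.
  rewrite deriveV //; [|exact: f0|by apply: diff_derivable; exact: (Cf y Uy).1].
  by rewrite !fctE /GRing.scale /= mulN1r expr2 invfM.
apply: Ck_onM => //; last by move=> y Uy; exact: (Cf y Uy).2.
apply: Ck_onM => //; first by move=> y _; exact: Ck_cst.
by apply: Ck_onM => //; exact: IH.
Qed.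

End flat_functions.

Section bumps.
Context {R : realType}.

Lemma norm_coord_le n (x : 'rV[R]_n) i : `|x 0 i| <= `|x|.
Proof.
by rewrite [leRHS]/Num.norm /= mx_normrE; apply/bigmax_geP; right => /=; exists (0, i).
Qed.

(** The quotient [a / (a + b)] of flat functions is 1 where [b] vanishes and 0
    where [a] does; the two never vanish together. *)
Lemma exists_bump_line (r : R) : 0 < r -> exists s : R -> R,
  [/\ forall n k (f : 'rV[R]_n -> R), Ck_on k setT f -> Ck_on k setT (s \o f),
      forall t, `|t| <= r / 2 -> s t = 1 &
      forall t, r <= `|t| -> s t = 0].
Proof.
move=> r0.
pose a (t : R) := flat 0 (r ^+ 2 + - t ^+ 2).
pose b (t : R) := flat 0 (t ^+ 2 + - (r / 2) ^+ 2).
have ab t : a t + b t != 0.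
  rewrite gt_eqF //.
  have [h|h] := ltP 0 (r ^+ 2 + - t ^+ 2).
    by rewrite ltr_pwDl ?flat_gt0 ?flat_ge0.
  rewrite ltr_pwDr ?flat_ge0 // flat_gt0 //; nra.
exists (fun t => a t * (a t + b t)^-1); split.
- move=> n k f Cf.
  have oT : open [set: 'rV[R]_n] by exact: openT.
  have Cf2 : Ck_on k setT (f * f) by exact: Ck_onM.
  have Cc (c : R) : Ck_on k [set: 'rV[R]_n] (cst c) by move=> x _; exact: Ck_cst.
  have Ca : Ck_on k setT (a \o f).
    rewrite (_ : a \o f = flat 0 \o (cst (r ^+ 2) + cst (-1) * (f * f))).
      by apply: Ck_on_flat => //; apply: Ck_onD => //; exact: Ck_onM.
    by apply/funext => x; rewrite /a /= !fctE /= mulN1r expr2.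
  have Cb : Ck_on k setT (b \o f).
    rewrite (_ : b \o f = flat 0 \o (f * f + cst (- (r / 2) ^+ 2))).
      by apply: Ck_on_flat => //; exact: Ck_onD.
    by apply/funext => x; rewrite /b /= !fctE /= expr2.
  apply: (@Ck_onM _ _ _ _ (a \o f) (fun x => (((a \o f) + (b \o f)) x)^-1)) => //.
  apply: Ck_onV => //; first by move=> x _; exact: ab.
  exact: Ck_onD.
- move=> t tr; rewrite (_ : b t = 0) ?addr0 ?mulfV //.
    by have := ab t; rewrite /b flat_le0 ?addr0 // subr_le0 -real_normK ?num_real // lerXn2r // nnegrE; lra.
  by rewrite /b flat_le0 ?addr0 // subr_le0 -real_normK ?num_real // lerXn2r // nnegrE; lra.
- move=> t tr; rewrite /a flat_le0 ?mul0r // subr_le0 -[t ^+ 2]real_normK ?num_real //.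
  by rewrite lerXn2r // nnegrE; lra.
Qed.

(** The norm of row vectors is the maximum of the coordinates, and so a product
    of one-variable bumps fits its balls. *)
Lemma exists_bump n (x0 : 'rV[R]_n) (r : R) : 0 < r ->
  exists rho : 'rV[R]_n -> R,
  [/\ forall k, Ck_on k setT rho,
      forall x, `|x - x0| <= r / 2 -> rho x = 1 &
      forall x, r <= `|x - x0| -> rho x = 0].
Proof.
move=> r0; have [s [Cs s1 s0]] := exists_bump_line r0.
exists (\prod_i (fun x => s (x 0 i - x0 0 i))); split.
- move=> k; elim/big_ind : _ => [x _|f g|i _]; first exact: Ck_cst.
    by apply: Ck_onM; exact: openT.
  apply: (Cs _ _ (fun x : 'rV_n => x 0 i - x0 0 i)).
  apply: (@Ck_onD _ _ _ _ (fun x : 'rV_n => x 0 i) (cst (- x0 0 i))).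
  + exact: openT.
  + by move=> x _; exact: Ck_coord.
  + by move=> x _; exact: Ck_cst.
- move=> x xr; rewrite fct_prodE big1 // => i _; apply: s1.
  by apply: le_trans xr; have := norm_coord_le (x - x0) i; rewrite !mxE.
- move=> x xr.
  have [|[k i] /= xi] := @mx_norm_neq0 _ _ _ (x - x0).
    by rewrite gt_eqF // (lt_le_trans r0).
  rewrite fct_prodE (bigD1 i) //= s0 ?mul0r //.
  by apply: le_trans xr _; rewrite [leLHS]/Num.norm /= xi (ord1 k) !mxE.
Qed.

End bumps.

(** * Hadamard's lemma *)

Section integral01.
Context {R : realType}.

Definition int01 (f : R -> R) : R := \int[lebesgue_measure]_(t in `[0, 1]) f t.

Lemma int01_integrable (f : R -> R) : continuous f ->
  (@lebesgue_measure R).-integrable `[0, 1] (EFin \o f).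
Proof.
move=> cf; apply: continuous_compact_integrable; first exact: segment_compact.
exact: continuous_subspaceT.
Qed.

Lemma int01D (f g : R -> R) : continuous f -> continuous g ->
  int01 (fun t => f t + g t) = int01 f + int01 g.
Proof. by move=> cf cg; rewrite /int01 RintegralD //; exact: int01_integrable. Qed.

Lemma int01Z (a : R) (f : R -> R) : continuous f ->
  int01 (fun t => a * f t) = a * int01 f.
Proof. by move=> cf; rewrite /int01 RintegralZl //; exact: int01_integrable. Qed.

Lemma int01B (f g : R -> R) : continuous f -> continuous g ->
  int01 (fun t => f t - g t) = int01 f - int01 g.
Proof.
move=> cf cg; rewrite -mulN1r -int01Z // -int01D //.
  by congr int01; apply/funext => t; rewrite mulN1r.
by move=> t; apply: cvgM; [exact: cst_continuous|exact: cg].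
Qed.

Lemma continuous_sum (I : Type) (r : seq I) (f : I -> R -> R) :
  (forall i, continuous (f i)) -> continuous (fun t => \sum_(i <- r) f i t).
Proof.
move=> cf; elim: r => [|i r IH].
  by under eq_fun do rewrite big_nil; exact: cst_continuous.
under eq_fun do rewrite big_cons.
by move=> t; apply: cvgD; [exact: cf|exact: IH].
Qed.

Lemma int01_sum (I : Type) (r : seq I) (f : I -> R -> R) :
  (forall i, continuous (f i)) ->
  int01 (fun t => \sum_(i <- r) f i t) = \sum_(i <- r) int01 (f i).
Proof.
move=> cf; elim: r => [|i r IH].
  rewrite big_nil; under eq_fun do rewrite big_nil.
  by have := @int01Z 0 (fun=> 0) (@cst_continuous _ _ _); rewrite !mul0r.
rewrite big_cons -IH -int01D //; last exact: continuous_sum.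
by under eq_fun do rewrite big_cons.
Qed.

Lemma int01_norm_le (f : R -> R) C : continuous f ->
  (forall t, 0 <= t <= 1 -> `|f t| <= C) -> `|int01 f| <= C.
Proof.
move=> cf fC; apply: le_trans (le_normr_Rintegral _ _) _ => //.
  exact: int01_integrable.
have cnf : continuous (fun t => `|f t|).
  by move=> t; apply: continuous_comp; [exact: cf|exact: norm_continuous].
apply: (@le_trans _ _ (int01 (cst C))).
  apply: le_Rintegral => //.
    exact: (int01_integrable cnf).
  by apply: int01_integrable; exact: cst_continuous.
rewrite /int01 Rintegral_cst //=.
have -> : lebesgue_measure (`[0, 1]%classic : set R) = 1%:E.
  by rewrite lebesgue_measure_itv /= lte_fin ltr01 -EFinB subr0.
by rewrite mulr1.
Qed.

Lemma int01_derive (F f : R -> R) : continuous f ->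
  (forall t : R, is_derive t 1 F (f t)) -> int01 f = F 1 - F 0.
Proof.
move=> cf dF.
have cF : continuous F.
  by move=> t; apply/differentiable_continuous/derivable1_diffP; case: (dF t).
rewrite /int01 /Rintegral (@continuous_FTC2 _ f F) ?ltr01 //.
- exact: continuous_subspaceT.
- split; first by move=> t _; case: (dF t).
    by apply: cvg_at_right_filter; exact: cF.
  by apply: cvg_at_left_filter; exact: cF.
- by move=> t _; rewrite derive1E; case: (dF t).
Qed.

End integral01.

Section several_variables.
Context {R : realType}.

Lemma is_derive_line (V : normedModType R) (f : V -> R) (x v : V) (t : R) :
  differentiable f (x + t *: v) ->
  is_derive t 1 (fun s : R => f (x + s *: v)) ('D_v f (x + t *: v)).
Proof.
move=> df.
have E : (fun h : R => h^-1 *: (f (x + (h *: (1:R) + t) *: v) - f (x + t *: v))) =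
         (fun h : R => h^-1 *: (f (h *: v + (x + t *: v)) - f (x + t *: v))).
  apply/funext => h; congr (_ *: (f _ - _)).
  by rewrite [h *: 1]mulr1 scalerDl addrCA.
have : derivable f (x + t *: v) v by exact: diff_derivable.
rewrite /derivable -E => dv.
by apply: DeriveDef => //; rewrite /derive E.
Qed.

Lemma derive_sum_coord n (f : 'rV[R]_n -> R) x v : differentiable f x ->
  'D_v f x = \sum_i v 0 i * 'D_(delta_mx 0 i) f x.
Proof.
move=> df; rewrite deriveE // [in LHS](row_sum_delta v) linear_sum /=.
by apply: eq_bigr => i _; rewrite linearZ /= -deriveE.
Qed.

Lemma mean_value n (f : 'rV[R]_n -> R) (x v : 'rV[R]_n) :
  (forall t : R, 0 <= t <= 1 -> differentiable f (x + t *: v)) ->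
  exists2 t : R, 0 <= t <= 1 &
    f (x + v) - f x = \sum_i v 0 i * 'D_(delta_mx 0 i) f (x + t *: v).
Proof.
move=> df.
have dg (t : R) : 0 <= t <= 1 ->
    is_derive t (1 : R) (fun s => f (x + s *: v)) ('D_v f (x + t *: v)).
  by move=> t01; apply: is_derive_line; exact: df.
have [||t] := @MVT_segment R (fun s => f (x + s *: v)) (fun t => 'D_v f (x + t *: v))
  0 1 ler01.
- by move=> t; rewrite in_itv /= => /andP[t0 t1]; apply: dg; rewrite !ltW.
- apply: derivable_within_continuous => t; rewrite in_itv /= => t01.
  by case: (dg t t01).
rewrite in_itv /= => t01; rewrite scale1r scale0r addr0 subr0 mulr1 => E.
by exists t => //; rewrite E derive_sum_coord //; exact: df.
Qed.

Lemma diff0_of_littleo (V : normedModType R) (g : V -> R) x :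
  (forall e, 0 < e -> \forall h \near (0 : V), `|g (h + x) - g x| <= e * `|h|) ->
  differentiable g x /\ 'd g x = \0 :> (V -> R).
Proof.
move=> go.
have c0 : continuous (\0 : V -> R) by move=> y; exact: cvg_cst.
have gx : g \o shift x = cst (g x) + (\0 : {linear V -> R}) +o_ 0 id.
  apply/eqaddoP => e /go; apply: filterS => h.
  by rewrite !fctE /= addr0.
have dg := diff_unique c0 gx.
by split => //; apply/diff_locallyP; rewrite dg.
Qed.

Lemma derive_coord n (x v : 'rV[R]_n) j :
  'D_v (fun y : 'rV[R]_n => y 0 j) x = v 0 j.
Proof.
have /matrixP/(_ 0 j) := derive_mx (@derivable_id _ _ x v).
by rewrite derive_id mxE => ->.
Qed.

(** Subtracting the linear candidate reduces the claim to a function whose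
    differential is zero. *)
Lemma differentiable_of_approx n (f : 'rV[R]_n -> R) x (c : 'I_n -> R) :
  (forall e, 0 < e -> \forall v \near (0 : 'rV[R]_n),
     `|f (v + x) - f x - \sum_i v 0 i * c i| <= e * `|v|) ->
  differentiable f x /\ forall i, 'D_(delta_mx 0 i) f x = c i.
Proof.
move=> fc.
pose A := \sum_i (c i \*: (fun y : 'rV[R]_n => y 0 i)).
have AE y : A y = \sum_i y 0 i * c i.
  by rewrite /A fct_sumE; apply: eq_bigr => i _; rewrite [RHS]mulrC.
have dA y : differentiable A y.
  by apply: differentiable_sum => i; exact/differentiableZ/differentiable_coord.
have [|dg dg0] := @diff0_of_littleo _ (f - A) x.
  move=> e /fc; apply: filterS => v.
  have -> // : (f - A) (v + x) - (f - A) x = f (v + x) - f x - \sum_i v 0 i * c i.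
  rewrite !fctE !AE; under eq_bigr do rewrite mxE mulrDl.
  by rewrite big_split /=; ring.
have fE : f = (f - A) + A by rewrite subrK.
split; first by rewrite fE; exact: differentiableD.
move=> i; rewrite fE deriveD; try exact: diff_derivable.
rewrite deriveE // dg0 add0r derive_sum; last first.
  by move=> j; apply/diff_derivable/differentiableZ/differentiable_coord.
rewrite (bigD1 i) //= big1 ?addr0 => [|j ji].
  rewrite deriveZ; last exact/diff_derivable/differentiable_coord.
  by rewrite derive_coord mxE !eqxx [LHS]mulr1.
rewrite deriveZ; last exact/diff_derivable/differentiable_coord.
by rewrite derive_coord mxE (negbTE ji) andbF [LHS]mulr0.
Qed.

(** Compactness of [[0, 1]] makes continuity at the points of the segment
    [{t x}] uniform in [t]. *)
Lemma continuous_scale_uniform n (g : 'rV[R]_n -> R) (x : 'rV[R]_n) e :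
  continuous g -> 0 < e ->
  \forall y \near x, forall t : R, 0 <= t <= 1 -> `|g (t *: y) - g (t *: x)| <= e.
Proof.
move=> cg e0.
have e20 : 0 < e / 2 by rewrite divr_gt0.
have /compact_near_coveringP K := @segment_compact R 0 1.
suff cover (t : R) : 0 <= t <= 1 -> \forall s \near t & y \near x,
    `|g (s *: y) - g (s *: x)| <= e.
  have h : \forall y \near nbhs x, `[0, 1] `<=` (fun t : R => `|g (t *: y) - g (t *: x)| <= e).
    apply: (K _ (nbhs x) (fun y t => `|g (t *: y) - g (t *: x)| <= e)) => t.
    by rewrite /= in_itv /=; exact: cover.
  by apply: filterS h => y h t t01; apply: h; rewrite /= in_itv.
move=> _.
have c1 : {for (t, x), continuous (fun p : R * 'rV[R]_n => g (p.1 *: p.2))}.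
  apply: (@continuous_comp _ _ _ (fun p : R * 'rV[R]_n => p.1 *: p.2) g); last exact: cg.
  exact: scale_continuous.
have c2 : {for (t, x), continuous (fun p : R * 'rV[R]_n => g (p.1 *: x))}.
  apply: (@continuous_comp _ _ _ (fun p : R * 'rV[R]_n => p.1 *: x) g); last exact: cg.
  apply: (@continuous_comp _ _ _ (fun p : R * 'rV[R]_n => p.1) (fun s : R => s *: x)).
    exact: cvg_fst.
  exact: scalel_continuous.
have := continuousB c1 c2; rewrite /prop_for /continuous_at !fctE /= subrr.
by move=> /cvgr0Pnorm_le /(_ _ e0).
Qed.

(** The weights [t ^ m] are there because differentiating [h (t x)] in [x] brings
    out a factor [t]. *)
Definition radial_mean n m (h : 'rV[R]_n -> R) (x : 'rV[R]_n) : R :=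
  int01 (fun t => t ^+ m * h (t *: x)).

Lemma continuous_ray n m (h : 'rV[R]_n -> R) x :
  continuous h -> continuous (fun t : R => t ^+ m * h (t *: x)).
Proof.
move=> ch t; apply: cvgM; first exact: exprn_continuous.
apply: (@continuous_comp _ _ _ (fun t : R => t *: x) h); last exact: ch.
exact: scalel_continuous.
Qed.

Lemma radial_mean_continuous n m (h : 'rV[R]_n -> R) :
  continuous h -> continuous (radial_mean m h).
Proof.
move=> ch x; apply/(@cvgrPdist_le _ _ _ (nbhs x)) => e e0.
near=> y.
have hy : forall t : R, 0 <= t <= 1 -> `|h (t *: y) - h (t *: x)| <= e.
  by near: y; exact: continuous_scale_uniform.
rewrite distrC -int01B; try exact: continuous_ray.
apply: int01_norm_le => [t|t t01].
  by apply: cvgB; exact: continuous_ray.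
rewrite -mulrBr normrM -[leRHS]mul1r ler_pM ?hy //.
case/andP: t01 => t0 t1.
by rewrite normrX ger0_norm // exprn_ile1.
Unshelve. all: by end_near. Qed.

(** Differentiation under the integral sign. The mean value theorem turns the
    increment of [h] on the ray into partial derivatives at nearby points, which
    are uniformly close to those on the ray. *)
Lemma radial_mean_approx n m (h : 'rV[R]_n -> R) x :
  (forall k y, Ck k h y) -> forall e, 0 < e ->
  \forall v \near (0 : 'rV[R]_n),
   `|radial_mean m h (v + x) - radial_mean m h x -
      \sum_i v 0 i * radial_mean m.+1 (fun y => 'D_(delta_mx 0 i) h y) x| <= e * `|v|.
Proof.
move=> Ch e e0.
pose d i := fun y => 'D_(delta_mx 0 i) h y.
have cd i : continuous (d i) by move=> y; exact: (Ch 1%N y).2 i.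
have ch : continuous h by move=> y; exact: (Ch 0%N y).
have dh y : differentiable h y by exact: (Ch 1%N y).1.
(* each of the n coordinates contributes at most e' |v| *)
pose e' := e / n.+1%:R.
have e'0 : 0 < e' by rewrite divr_gt0.
have near_d i : \forall y \near x, forall t : R, 0 <= t <= 1 ->
    `|d i (t *: y) - d i (t *: x)| <= e' by exact: continuous_scale_uniform.
have : \forall y \near x, forall i, forall t : R, 0 <= t <= 1 ->
    `|d i (t *: y) - d i (t *: x)| <= e'.
  apply: (@filter_forall _ 'I_n (fun i y => forall t : R, 0 <= t <= 1 ->
    `|d i (t *: y) - d i (t *: x)| <= e') (nbhs x)).
  exact: near_d.
move=> /nbhs_ballP[r /= r0 rd].
have : \forall v \near (0 : 'rV[R]_n), ball (0 : 'rV[R]_n) r v by exact: nbhsx_ballx.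
apply: filterS => v; rewrite -ball_normE /= sub0r normrN => vr.
have cterm i : continuous (fun t : R => v 0 i * (t ^+ m.+1 * d i (t *: x))).
  by move=> t; apply: cvgM; [exact: cvg_cst|exact: continuous_ray].
have cs := @continuous_sum _ _ (index_enum _) _ cterm.
have cB : continuous (fun t : R => t ^+ m * h (t *: (v + x)) - t ^+ m * h (t *: x)).
  by move=> t; apply: cvgB; exact: continuous_ray.
have -> : radial_mean m h (v + x) - radial_mean m h x -
      \sum_i v 0 i * radial_mean m.+1 (d i) x =
   int01 (fun t => t ^+ m * h (t *: (v + x)) - t ^+ m * h (t *: x) -
     \sum_i v 0 i * (t ^+ m.+1 * d i (t *: x))).
  rewrite int01B // int01B; try exact: continuous_ray.
  rewrite int01_sum //; congr (_ - _); apply: eq_bigr => i _.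
  by rewrite int01Z //; exact: continuous_ray.
apply: int01_norm_le => [t|t t01]; first by apply: cvgB; [exact: cB|exact: cs].
have [s s01 E] := @mean_value n h (t *: x) (t *: v) (fun _ _ => dh _).
have xs : ball x r (x + s *: v).
  rewrite -ball_normE /= opprD addrA subrr add0r normrN normrZ.
  case/andP: s01 => s0 s1; rewrite ger0_norm //.
  by apply: le_lt_trans vr; rewrite ler_piMl.
case/andP: (t01) => t0 t1.
rewrite -mulrBr [v + x]addrC scalerDr E mulr_sumr -sumrB.
apply: le_trans (ler_norm_sum _ _ _) _.
apply: (@le_trans _ _ (\sum_(i < n) e' * `|v|)).
  apply: ler_sum => i _; rewrite mxE.
  rewrite (_ : _ - _ = t ^+ m.+1 * ((d i (t *: (x + s *: v)) - d i (t *: x)) * v 0 i)); last first.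
    by rewrite /d exprS scalerDr !scalerA [t * s]mulrC; ring.
  rewrite normrM -[leRHS]mul1r ler_pM //.
    by rewrite normrX ger0_norm // exprn_ile1.
  by rewrite normrM ler_pM ?norm_coord_le // rd.
rewrite sumr_const card_ord -mulr_natr mulrAC ler_wpM2r //.
by rewrite /e' -mulrA ler_piMr ?(ltW e0) // mulrC ler_pdivrMr // mul1r ler_nat.
Qed.

Definition smooth n (f : 'rV[R]_n -> R) := forall k x, Ck k f x.

Lemma smooth_derive n (f : 'rV[R]_n -> R) i :
  smooth f -> smooth (fun x => 'D_(delta_mx 0 i) f x).
Proof. by move=> sf k x; exact: (sf k.+1 x).2. Qed.

Lemma smooth_radial_mean n m (h : 'rV[R]_n -> R) :
  smooth h -> smooth (radial_mean m h).
Proof.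
move=> sh k; elim: k m h sh => [|k IH] m h sh x.
  by apply: radial_mean_continuous => y; exact: (sh 0%N).
have D y := differentiable_of_approx (radial_mean_approx m y sh).
split; first exact: (D x).1.
move=> i; rewrite (_ : (fun y => _) =
    radial_mean m.+1 (fun y => 'D_(delta_mx 0 i) h y)).
  by apply: IH; exact: smooth_derive.
by apply/funext => y; exact: (D y).2.
Qed.

(** Integrate the derivative of [t |-> f (t x)] over [[0, 1]]. *)
Lemma hadamard0 n (f : 'rV[R]_n -> R) : smooth f ->
  exists2 g : 'I_n -> 'rV[R]_n -> R, (forall i, smooth (g i)) &
    forall x, f x = f 0 + \sum_i x 0 i * g i x.
Proof.
move=> sf; exists (fun i => radial_mean 0 (fun y => 'D_(delta_mx 0 i) f y)).
  by move=> i; apply/smooth_radial_mean/smooth_derive.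
move=> x; apply/eqP; rewrite addrC -subr_eq; apply/eqP.
have cd i : continuous (fun y => 'D_(delta_mx 0 i) f y).
  by move=> y; exact: (sf 1%N y).2 i.
have cg i := @continuous_ray _ 0 _ x (cd i).
have cxg i : continuous (fun t : R => x 0 i * (t ^+ 0 * 'D_(delta_mx 0 i) f (t *: x))).
  by move=> t; apply: cvgM; [exact: cvg_cst|exact: cg].
have dF (t : R) : is_derive t 1 (fun t : R => f (t *: x))
    (\sum_i x 0 i * (t ^+ 0 * 'D_(delta_mx 0 i) f (t *: x))).
  under eq_bigr do rewrite expr0 mul1r.
  have df : differentiable f (t *: x) by exact: (sf 1%N _).1.
  rewrite -derive_sum_coord //.
  have := @is_derive_line _ f 0 x t; rewrite add0r => /(_ df).
  by under eq_fun do rewrite add0r.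
have := int01_derive (@continuous_sum _ _ (index_enum _) _ cxg) dF.
rewrite scale1r scale0r => <-.
by rewrite int01_sum //; apply: eq_bigr => i _; rewrite int01Z.
Qed.

Lemma smooth_shift n (f : 'rV[R]_n -> R) a : smooth f -> smooth (fun x => f (x + a)).
Proof.
move=> sf k x.
apply: (@Ck_on_comp _ _ _ k setT (fun x => x + a) f) => //; first exact: openT.
move=> j; apply: (@eq_Ck_on _ _ _ setT ((fun y : 'rV_n => y 0 j) + cst (a 0 j))).
- exact: openT.
- by move=> y _; rewrite mxE.
- apply: Ck_onD; first exact: openT.
    by move=> y _; exact: Ck_coord.
  by move=> y _; exact: Ck_cst.
Qed.

(** The value of [g i] at [a] is necessarily the [i]-th partial derivative of [f]. *)
Lemma hadamard n (f : 'rV[R]_n -> R) a : smooth f ->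
  exists2 g : 'I_n -> 'rV[R]_n -> R, (forall i, smooth (g i)) &
    forall x, f x = f a + \sum_i (x 0 i - a 0 i) * g i x.
Proof.
move=> sf; have [g sg fg] := hadamard0 (smooth_shift a sf).
exists (fun i x => g i (x - a)); first by move=> i; exact: smooth_shift.
move=> x; have := fg (x - a); rewrite subrK add0r => ->.
by congr (_ + _); apply: eq_bigr => i _; rewrite !mxE.
Qed.

End several_variables.

(** * Symmetry of second derivatives, and cutoffs *)

Section cutoff.
Context {R : realType}.

Lemma differentiable_coord_combination n (a x : 'rV[R]_n)
    (u : 'I_n -> 'rV[R]_n -> R) : (forall i, differentiable (u i) x) ->
  differentiable (fun y : 'rV[R]_n => \sum_i (y 0 i - a 0 i) * u i y) x.
Proof.
move=> du; rewrite (_ : (fun y => _) =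
    \sum_i (fun y : 'rV[R]_n => (y 0 i - a 0 i) * u i y)); last first.
  by apply/funext => y; rewrite fct_sumE.
apply: differentiable_sum => i; apply: differentiableM => //.
by apply: differentiableB; [exact: differentiable_coord|exact: differentiable_cst].
Qed.

Lemma derive_coord_combination n (a x : 'rV[R]_n) (u : 'I_n -> 'rV[R]_n -> R) j :
  (forall i, differentiable (u i) x) ->
  'D_(delta_mx 0 j) (fun y : 'rV[R]_n => \sum_i (y 0 i - a 0 i) * u i y) x =
  u j x + \sum_i (x 0 i - a 0 i) * 'D_(delta_mx 0 j) (u i) x.
Proof.
move=> du.
have dc i : differentiable (fun y : 'rV[R]_n => y 0 i - a 0 i) x.
  by apply: differentiableB; [exact: differentiable_coord|exact: differentiable_cst].
have D i : derivable (fun y : 'rV[R]_n => (y 0 i - a 0 i) * u i y) x (delta_mx 0 j).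
  by apply/diff_derivable/differentiableM.
rewrite (_ : (fun y => _) = \sum_i (fun y : 'rV[R]_n => (y 0 i - a 0 i) * u i y));
  last by apply/funext => y; rewrite fct_sumE.
rewrite derive_sum //.
have E i : 'D_(delta_mx 0 j) (fun y : 'rV[R]_n => (y 0 i - a 0 i) * u i y) x =
    (i == j)%:R * u i x + (x 0 i - a 0 i) * 'D_(delta_mx 0 j) (u i) x.
  rewrite (@deriveM _ _ (fun y : 'rV[R]_n => y 0 i - a 0 i) (u i)); try exact: diff_derivable.
  rewrite (@deriveB _ _ _ (fun y : 'rV[R]_n => y 0 i) (fun _ => a 0 i)); first last.
  - exact: derivable_cst.
  - exact/diff_derivable/differentiable_coord.
  rewrite derive_cst subr0 derive_coord mxE eqxx /= addrC; congr (_ + _).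
  by rewrite mulrC.
rewrite (eq_bigr _ (fun i _ => E i)) big_split /=; congr (_ + _).
rewrite (bigD1 j) //= eqxx mul1r big1 ?addr0 // => i /negbTE ->.
by rewrite mul0r.
Qed.

(** With [f = f(a) + sum_i (x_i - a_i) g_i], both iterated derivatives at [a] are
    equal to [d_j g_i + d_i g_j], where the terms with a factor [x_i - a_i] have
    dropped out. *)
Lemma smooth_derive_comm n (f : 'rV[R]_n -> R) a i j : smooth f ->
  'D_(delta_mx 0 j) (fun x => 'D_(delta_mx 0 i) f x) a =
  'D_(delta_mx 0 i) (fun x => 'D_(delta_mx 0 j) f x) a.
Proof.
move=> sf; have [g sg fE] := hadamard a sf.
have dg l x : differentiable (g l) x by exact: (sg l 1%N x).1.
have D1 l x : 'D_(delta_mx 0 l) f x =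
    g l x + \sum_k (x 0 k - a 0 k) * 'D_(delta_mx 0 l) (g k) x.
  rewrite (_ : f = cst (f a) + (fun x : 'rV[R]_n => \sum_i (x 0 i - a 0 i) * g i x)); last first.
    by apply/funext => y; rewrite fE.
  rewrite deriveD; last 2 first.
  - exact: derivable_cst.
  - exact/diff_derivable/differentiable_coord_combination.
  by rewrite derive_cst add0r derive_coord_combination.
have D2 l m : 'D_(delta_mx 0 m) (fun x => 'D_(delta_mx 0 l) f x) a =
    'D_(delta_mx 0 m) (g l) a + 'D_(delta_mx 0 l) (g m) a.
  have dDg k x : differentiable (fun y => 'D_(delta_mx 0 l) (g k) y) x.
    exact: (smooth_derive l (sg k) 1%N x).1.
  rewrite (_ : (fun x => _) = g l +
      (fun x : 'rV[R]_n => \sum_k (x 0 k - a 0 k) * 'D_(delta_mx 0 l) (g k) x)); last first.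
    by apply/funext => x; rewrite D1.
  rewrite deriveD; last 2 first.
  - exact: diff_derivable.
  - exact/diff_derivable/differentiable_coord_combination.
  rewrite derive_coord_combination //; congr (_ + _).
  by rewrite big1 ?addr0 // => k _; rewrite subrr mul0r.
by rewrite !D2 addrC.
Qed.

Lemma exists_cutoff n (U : set 'rV[R]_n) x0 : open U -> U x0 ->
  exists rho K, [/\ smooth rho, \forall x \near x0, rho x = 1, compact K, K `<=` U &
    forall x, ~ K x -> rho x = 0].
Proof.
move=> oU Ux0.
have /nbhs_ballP[r /= r0 rU] : nbhs x0 U by exact: open_nbhs_nbhs.
have r20 : 0 < r / 2 by rewrite divr_gt0.
have [rho [Crho rho1 rho0]] := exists_bump x0 r20.
exists rho, (closed_ball x0 (r / 2)); split.
- by move=> k x; exact: Crho.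
- have : \forall x \near x0, ball x0 (r / 2 / 2) x.
    by apply: nbhsx_ballx; rewrite divr_gt0.
  apply: filterS => x; rewrite -ball_normE /= distrC => /ltW; exact: rho1.
- apply: bounded_closed_compact; last exact: closed_ball_closed.
  exists (`|x0| + r / 2); split; first by rewrite num_real.
  move=> M hM x; rewrite closed_ballE // /closed_ball_ /= => xr.
  rewrite -[x](subrK x0); apply: le_trans (ler_normD _ _) _.
  by rewrite addrC ltW // (le_lt_trans _ hM) // lerD2l distrC.
- move=> x; rewrite closed_ballE // /closed_ball_ /= => xr; apply: rU.
  by rewrite -ball_normE /=; apply: le_lt_trans xr _; rewrite ltr_pdivrMr ?ltr_pMr ?ltr1n.
- move=> x; rewrite closed_ballE // /closed_ball_ /= => /negP; rewrite -ltNge => /ltW.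
  by rewrite distrC; exact: rho0.
Qed.

(** Near a point outside of [K] the product is zero, whatever [f] does there. *)
Lemma smooth_cutoff n (U K : set 'rV[R]_n) (rho f : 'rV[R]_n -> R) :
  open U -> closed K -> K `<=` U -> smooth rho -> (forall x, ~ K x -> rho x = 0) ->
  smooth_on U f -> smooth (fun x => rho x * f x).
Proof.
move=> oU cK KU sr r0 sf k x.
have [Kx|nKx] := pselect (K x).
  apply: (@Ck_onM _ _ _ U rho f) => //; exact: KU.
apply: (@near_Ck _ _ _ (cst 0)); last exact: Ck_cst.
have : nbhs x (~` K) by apply: open_nbhs_nbhs; split => //; exact: closed_openC.
by apply: filterS => y nKy; rewrite r0 // mul0r.
Qed.

Lemma compact_closed_rV n (K : set 'rV[R]_n) : compact K -> closed K.
Proof. by apply: compact_closed; exact: norm_hausdorff. Qed.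

Lemma smooth_on_germ n (U : set 'rV[R]_n) (f : 'rV[R]_n -> R) x0 :
  open U -> U x0 -> smooth_on U f ->
  exists2 g, smooth g & \forall x \near x0, f x = g x.
Proof.
move=> oU Ux0 sf.
have [rho [K [sr r1 cK KU r0]]] := exists_cutoff oU Ux0.
exists (fun x => rho x * f x).
  by apply: (smooth_cutoff oU _ KU) => //; exact: compact_closed_rV.
by move: r1; apply: filterS => x ->; rewrite mul1r.
Qed.

Lemma derive_comm n (U : set 'rV[R]_n) (f : 'rV[R]_n -> R) a i j :
  open U -> U a -> smooth_on U f ->
  'D_(delta_mx 0 j) (fun x => 'D_(delta_mx 0 i) f x) a =
  'D_(delta_mx 0 i) (fun x => 'D_(delta_mx 0 j) f x) a.
Proof.
move=> oU Ua /(smooth_on_germ oU Ua)[g sg fg].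
have E l m : 'D_(delta_mx 0 m) (fun x => 'D_(delta_mx 0 l) f x) a =
    'D_(delta_mx 0 m) (fun x => 'D_(delta_mx 0 l) g x) a.
  apply: near_eq_derive; have := near_join fg; apply: filterS => y.
  exact: near_eq_derive.
by rewrite !E smooth_derive_comm.
Qed.

Lemma derive0_locally_cst n (U : set 'rV[R]_n) (f : 'rV[R]_n -> R) a :
  open U -> U a -> (forall x, U x -> differentiable f x) ->
  (forall x i, U x -> 'D_(delta_mx 0 i) f x = 0) ->
  \forall x \near a, f x = f a.
Proof.
move=> oU Ua df d0.
have /nbhs_ballP[r /= r0 rU] : nbhs a U by exact: open_nbhs_nbhs.
have : \forall x \near a, ball a r x by exact: nbhsx_ballx.
apply: filterS => x; rewrite -ball_normE /= => xr.
have sub (t : R) : 0 <= t <= 1 -> U (a + t *: (x - a)).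
  move=> /andP[t0 t1]; apply: rU; rewrite -ball_normE /= opprD addrA subrr add0r.
  rewrite normrN normrZ ger0_norm // distrC.
  by apply: le_lt_trans xr; rewrite ler_piMl.
have [|t t01] := @mean_value _ _ f a (x - a).
  by move=> t /sub; exact: df.
rewrite addrCA subrr addr0 big1 => [/eqP|i _]; first by rewrite subr_eq0 => /eqP.
by rewrite d0 ?mulr0 //; exact: sub.
Qed.

End cutoff.

(** * Functions and tangent vectors on a manifold *)

Section local_functions.
Context {R : realType} (M : manifold R).
Local Notation n := (manifold_dim M).

Lemma chart_inv_near (T : topologicalType) m (c : chart R T m) x (P : set T) :
  chart_cod c x -> nbhs (chart_inv c x) P -> \forall y \near x, P (chart_inv c y).
Proof. by move=> cx nP; exact: (chart_inv_continuous cx nP). Qed.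

Lemma chart_fun_near (T : topologicalType) m (c : chart R T m) p (P : set 'rV[R]_m) :
  chart_dom c p -> nbhs (c p) P -> \forall q \near p, P (c q).
Proof. by move=> cp nP; exact: (chart_fun_continuous cp nP). Qed.

Lemma chart_dom_near (T : topologicalType) m (c : chart R T m) p :
  chart_dom c p -> \forall q \near p, chart_dom c q.
Proof. by move=> cp; apply: open_nbhs_nbhs; split => //; exact: chart_dom_open. Qed.

Lemma chart_cod_near (T : topologicalType) m (c : chart R T m) x :
  chart_cod c x -> \forall y \near x, chart_cod c y.
Proof. by move=> cp; apply: open_nbhs_nbhs; split => //; exact: chart_cod_open. Qed.

Lemma smooth_fun_of_germs (f : M -> R) :
  (forall p : M, exists g : Cinf M, \forall q \near p, f q = g q) -> is_smooth_fun f.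
Proof.
move=> fg c ac k x cx.
have [g fgE] := fg (chart_inv c x).
apply: (@near_Ck _ _ _ (g \o chart_inv c)); last exact: (CinfP g ac).
by have := chart_inv_near cx fgE; apply: filterS => y /= ->.
Qed.

Definition extend (c : chart R M n) (u : 'rV[R]_n -> R) (q : M) : R :=
  if `[< chart_dom c q >] then u (c q) else 0.

Lemma extendE c u q : chart_dom c q -> extend c u q = u (c q).
Proof. by move=> cq; rewrite /extend asboolT. Qed.

(** Off the domain of [c] the extension is locally zero because the image of [K]
    is compact, hence closed: this is where M has to be Hausdorff. *)
Lemma extend_smooth (c : chart R M n) (u : 'rV[R]_n -> R) (K : set 'rV[R]_n) :
  atlas c -> compact K -> K `<=` chart_cod c -> (forall x, ~ K x -> u x = 0) ->
  smooth_on (chart_cod c) u -> is_smooth_fun (extend c u).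
Proof.
move=> ac cK KU u0 su d ad k x dx.
have [cq|ncq] := pselect (chart_dom c (chart_inv d x)).
  pose U := [set y | chart_cod d y /\ chart_dom c (chart_inv d y)].
  have oU : open U := @smooth_in_charts_open _ _ _ _ _ d c id (fun x => cvg_id).
  apply: (@eq_Ck_on _ _ _ U (u \o (fun y => c (chart_inv d y)))) => //.
    by move=> y /[1!inE] -[dy cy]; rewrite /= extendE.
  apply: Ck_on_comp => //; first by move=> j; exact: (atlas_compatible ad ac).
  by move=> y [dy cy]; apply: su; exact: chart_funP.
have cK' : closed (chart_inv c @` K).
  apply: compact_closed; first exact: manifold_hausdorff.
  apply: continuous_compact => //.
  move=> y; apply: continuous_in_subspaceT => z /[1!inE] Kz.
  exact/chart_inv_continuous/KU.
apply: (@near_Ck _ _ _ (cst 0)); last exact: Ck_cst.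
have nK : nbhs (chart_inv d x) (~` (chart_inv c @` K)).
  apply: open_nbhs_nbhs; split; first exact: closed_openC.
  by move=> [z Kz zE]; apply: ncq; rewrite -zE; exact/chart_invP/KU.
have := chart_inv_near dx nK; apply: filterS => y nKy /=.
rewrite /extend; case: asboolP => // cy; rewrite u0 // => Ky.
by apply: nKy; exists (c (chart_inv d y)) => //; rewrite chart_funK.
Qed.

Lemma exists_bump_function (p : M) (W : set M) : nbhs p W ->
  exists psi : Cinf M, psi p = 1 /\ forall q, ~ W q -> psi q = 0.
Proof.
move=> nW; have [c ac cp] := atlas_cover p.
have : \forall x \near c p, chart_cod c x /\ W (chart_inv c x).
  near=> x; split; near: x; first exact/chart_cod_near/chart_funP.
  by apply: chart_inv_near; [exact: chart_funP|rewrite chart_funK].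
move=> /nbhs_interior nU.
have [rho [K [sr r1 cK KU r0]]] := exists_cutoff (open_interior _) (nbhs_singleton nU).
have sext : is_smooth_fun (extend c rho).
  apply: (extend_smooth ac cK) => //; last by move=> k x _; exact: sr.
  by move=> x /KU /interior_subset[].
exists (mkCinf sext); split.
  by rewrite /= extendE // (nbhs_singleton r1).
move=> q nWq; rewrite /= /extend; case: asboolP => // cq; apply: r0 => Kq.
apply: nWq; have /KU/interior_subset[_] := Kq.
by rewrite chart_funK.
Unshelve. all: by end_near. Qed.

End local_functions.

Section tangent_vectors.
Context {R : realType} (M : manifold R) (p : M).
Implicit Types (v : tangent p) (f g : Cinf M).

Lemma tangentP v : is_tangent p v.
Proof. by case: v => v dv; exact/asboolP. Qed.

Lemma tangentL v (a : R) f g : v (a *: f + g) = a * v f + v g.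
Proof. exact: (tangentP v).1. Qed.
Lemma tangentM v f g : v (f * g) = f p * v g + g p * v f.
Proof. exact: (tangentP v).2. Qed.
Lemma tangentD v f g : v (f + g) = v f + v g.
Proof. by have := tangentL v 1 f g; rewrite scale1r mul1r. Qed.
Lemma tangent0 v : v 0 = 0.
Proof. by apply: (addrI (v 0)); rewrite -tangentD !addr0. Qed.
Lemma tangentZ v (a : R) f : v (a *: f) = a * v f.
Proof. by have := tangentL v a f 0; rewrite !addr0 tangent0 addr0. Qed.
Lemma tangentN v f : v (- f) = - v f.
Proof. by rewrite -scaleN1r tangentZ mulN1r. Qed.
Lemma tangentB v f g : v (f - g) = v f - v g.
Proof. by rewrite tangentD tangentN. Qed.
Lemma tangent1 v : v 1 = 0.
Proof.
have := tangentM v 1 1; rewrite mulr1 CinfE !mul1r => /eqP.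
by rewrite -subr_eq0 opprD addNKr oppr_eq0 => /eqP.
Qed.
Lemma tangent_sum v (I : Type) (r : seq I) (F : I -> Cinf M) :
  v (\sum_(i <- r) F i) = \sum_(i <- r) v (F i).
Proof. by apply: (big_morph v (tangentD v) (tangent0 v)). Qed.

Lemma tangent_eqP v (w : tangent p) : v =1 w -> v = w.
Proof. by move=> vw; apply/val_inj/funext. Qed.

Lemma mkTangent_subproof (v : Cinf M -> R) :
  is_tangent p v -> (v : Cinf M -> R^o) \in tangents p.
Proof. exact: asboolT. Qed.

Definition mkTangent (v : Cinf M -> R) (vP : is_tangent p v) : tangent p :=
  MkTangent (mkTangent_subproof vP).

(** Tangent vectors are local: if [psi] is supported where [f = g] and
    [psi p = 1], then [v (psi * (f - g))] is both 0 and [v f - v g]. *)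
Lemma tangent_near v f g : (\forall q \near p, f q = g q) -> v f = v g.
Proof.
move=> fg; have [psi [psi1 psi0]] := exists_bump_function fg.
have E : psi * (f - g) = 0.
  apply: Cinf_eqP => q; rewrite !CinfE.
  have [->|/psi0 ->] := pselect (f q = g q); first by rewrite subrr mulr0.
  by rewrite mul0r.
apply/eqP; rewrite -subr_eq0 -tangentB -[v _]mul1r -psi1.
have := tangentM v psi (f - g); rewrite E tangent0 !CinfE (nbhs_singleton fg).
by rewrite subrr mul0r addr0 => <-.
Qed.
End tangent_vectors.

Lemma Cinf_sumE (R : realType) (M : manifold R) (I : Type) (r : seq I)
    (F : I -> Cinf M) q : (\sum_(i <- r) F i) q = \sum_(i <- r) F i q.
Proof. exact: (big_morph (fun f : Cinf M => f q) (fun f g => CinfDE f g q) (Cinf0E q)). Qed.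

Section partial_derivatives.
Context {R : realType} (M : manifold R).
Local Notation n := (manifold_dim M).

(** Partial derivatives are defined for arbitrary functions, so that they can be
    iterated although [pd c i f] is only meaningful on the domain of [c]. *)
Definition pd (c : chart R M n) (i : 'I_n) (f : M -> R) (q : M) : R :=
  'D_(delta_mx 0 i) (f \o chart_inv c) (c q).

Lemma Cinf_differentiable (c : chart R M n) (f : Cinf M) q : atlas c -> chart_dom c q ->
  differentiable (f \o chart_inv c) (c q).
Proof. by move=> ac cq; have := CinfP f ac 1%N (chart_funP cq) => -[]. Qed.

Lemma near_pd (c : chart R M n) i (f g : M -> R) q : chart_dom c q ->
  {near q, f =1 g} -> pd c i f q = pd c i g q.
Proof.
move=> cq fg; apply: near_eq_derive.
have := @chart_inv_near _ _ _ c (c q) (fun y => f y = g y) (chart_funP cq).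
by rewrite chart_funK //; apply.
Qed.

Lemma pd_tangent_subproof (c : chart R M n) i q : atlas c -> chart_dom c q ->
  is_tangent q (fun f => pd c i f q).
Proof.
move=> ac cq; have D f := Cinf_differentiable f ac cq.
have D' (f : Cinf M) : derivable (f \o chart_inv c) (c q) (delta_mx 0 i) by apply: diff_derivable; exact: D.
split=> [a f g|f g]; rewrite /pd.
  rewrite (_ : _ \o _ = (a \*: (f \o chart_inv c)) + (g \o chart_inv c)) //.
  rewrite deriveD //; last exact: derivableZ.
  by rewrite deriveZ.
rewrite (_ : _ \o _ = (f \o chart_inv c) * (g \o chart_inv c)) //.
by rewrite deriveM // /= chart_funK.
Qed.

Definition pd_tangent c i q (ac : atlas c) (cq : chart_dom c q) : tangent q :=
  mkTangent (pd_tangent_subproof i ac cq).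

End partial_derivatives.

(** * Local frames *)

Section frames.
Context {R : realType} (M : manifold R).
Local Notation n := (manifold_dim M).

(** The functions [x i] and vector fields [d i] are the coordinates and coordinate
    fields of [c], multiplied by a cutoff. For the expansion of [v] apply
    Hadamard's lemma to [f] in the chart: near [q],
    [f = f(q) + sum_i (x_i - x_i(q)) G_i] with [G_i] smooth on M and [G_i(q)] the
    [i]-th partial derivative, so the product rule determines [v f]. *)
Lemma exists_frame (c : chart R M n) (p : M) : atlas c -> chart_dom c p ->
  exists (x : 'I_n -> Cinf M) (d : 'I_n -> vfield M), \forall q \near p,
    [/\ chart_dom c q,
        forall i (f : Cinf M), d i f q = pd c i f q &
        forall (v : tangent q) f, v f = \sum_i v (x i) * pd c i f q].
Proof.
move=> ac cp.
have [rho [K [sr r1 cK KU r0]]] := exists_cutoff (@chart_cod_open _ _ _ c) (chart_funP cp).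
pose cut (u : 'rV[R]_n -> R) := extend c (fun z => rho z * u z).
have scut u : smooth_on (chart_cod c) u -> is_smooth_fun (cut u).
  move=> su; apply: (extend_smooth ac cK KU) => [z /r0 -> |]; first by rewrite mul0r.
  move=> k; apply: (@Ck_onM _ _ _ _ rho u); [exact: chart_cod_open| |exact: su].
  by move=> z _; exact: sr.
pose x i := mkCinf (scut (fun z : 'rV[R]_n => z 0 i) (fun k z _ => Ck_coord k i z)).
have sD i (f : Cinf M) : smooth_on (chart_cod c)
    (fun z => 'D_(delta_mx 0 i) (f \o chart_inv c) z).
  by move=> k z cz; exact: (CinfP f ac k.+1 cz).2.
pose d0 i f := mkCinf (scut _ (sD i f)).
have dE i f q (cq : chart_dom c q) : d0 i f q = rho (c q) * pd_tangent i ac cq f.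
  by rewrite /d0 /= /cut extendE.
have dN i f q : ~ chart_dom c q -> d0 i f q = 0.
  by rewrite /d0 /= /cut /extend; case: asboolP.
have dP i : is_derivation (d0 i).
  split=> [a f g|f g]; apply: Cinf_eqP => q; rewrite !CinfE.
    have [cq|ncq] := pselect (chart_dom c q); last by rewrite !dN // mulr0 addr0.
    by rewrite !(dE _ _ _ cq) tangentL; ring.
  have [cq|ncq] := pselect (chart_dom c q); last by rewrite !dN // !mulr0 addr0.
  by rewrite !(dE _ _ _ cq) tangentM; ring.
exists x, (fun i => mkVfield (dP i)).
have : \forall q \near p, chart_dom c q /\ \forall z \near c q, rho z = 1.
  near=> q; split; near: q; first exact: chart_dom_near.
  exact: (@chart_fun_near _ _ _ c p (fun z0 => \forall z \near z0, rho z = 1) cp (near_join r1)).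
(* where the cutoff is 1 only at q, it would change derivatives: it has to be 1
   around q *)
move=> nq; have := near_join nq; apply: filterS => q nqq.
have [cq rq] := nbhs_singleton nqq.
split => // [i f|v f].
  by rewrite [LHS](dE _ _ _ cq) (nbhs_singleton rq) mul1r.
pose F := fun z => rho z * f (chart_inv c z).
have sF : smooth F.
  apply: (smooth_cutoff _ _ KU) => //; [exact: chart_cod_open|exact: compact_closed_rV|].
  exact: (CinfP f ac).
have [g sg FE] := hadamard (c q) sF.
pose G i := mkCinf (scut (g i) (fun k z _ => sg i k z)).
have Fq : F (c q) = f q by rewrite /F (nbhs_singleton rq) mul1r chart_funK.
have pdE i : pd c i f q = G i q.
  rewrite [RHS]/= /cut extendE // (nbhs_singleton rq) mul1r.
  transitivity ('D_(delta_mx 0 i) F (c q)).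
    by apply: near_eq_derive; apply: filterS rq => z zE; rewrite /F zE mul1r.
  rewrite (_ : F = cst (F (c q)) + (fun z : 'rV[R]_n =>
      \sum_i (z 0 i - c q 0 i) * g i z)); last by apply/funext => z; rewrite FE.
  have dg j z : differentiable (g j) z by exact: (sg j 1%N z).1.
  rewrite deriveD; last 2 first.
  - exact: derivable_cst.
  - exact/diff_derivable/differentiable_coord_combination.
  rewrite derive_cst add0r derive_coord_combination //.
  by rewrite big1 ?addr0 // => k _; rewrite subrr mul0r.
have fE : \forall y \near q, f y =
    (f q *: (1 : Cinf M) + \sum_i (x i - x i q *: (1 : Cinf M)) * G i) y.
  have := nqq; apply: filterS => y [cy ry].
  have r1y := nbhs_singleton ry.
  rewrite !CinfE Cinf_sumE mulr1 -[in LHS](chart_funK cy).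
  have := FE (c y); rewrite /F r1y mul1r -/(F _) Fq => ->; congr (_ + _).
  apply: eq_bigr => i _; rewrite !CinfE mulr1 /= /cut !extendE // r1y.
  by rewrite (nbhs_singleton rq) !mul1r.
rewrite (tangent_near v fE) tangentD tangentZ tangent1 mulr0 add0r tangent_sum.
apply: eq_bigr => i _; rewrite tangentM tangentB tangentZ tangent1 mulr0 subr0.
by rewrite !CinfE mulr1 subrr mul0r add0r mulrC pdE.
Unshelve. all: by end_near. Qed.

End frames.

(** * Poisson calculus *)

Section poisson_calculus.
Context {R : realType} (M : manifold R).
Local Notation n := (manifold_dim M).

Lemma one_form0 (al : one_form M) : al 0 = 0.
Proof. by apply: (addrI (al 0)); rewrite -one_formD !addr0. Qed.

Lemma one_form_sum (al : one_form M) (I : Type) (r : seq I) (X : I -> vfield M) :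
  al (\sum_(i <- r) X i) = \sum_(i <- r) al (X i).
Proof. exact: (big_morph al (one_formD al) (one_form0 al)). Qed.

Lemma vfield_sumE (I : Type) (r : seq I) (X : I -> vfield M) f :
  (\sum_(i <- r) X i) f = \sum_(i <- r) X i f.
Proof. by apply: (big_morph (fun X : vfield M => X f)). Qed.

Lemma one_formZE (a : Cinf M) (al : one_form M) X : (a *: al) X = a * al X.
Proof. by []. Qed.

Lemma one_form_sumE (I : Type) (r : seq I) (al : I -> one_form M) X :
  (\sum_(i <- r) al i) X = \sum_(i <- r) al i X.
Proof. by apply: (big_morph (fun al : one_form M => al X)). Qed.

(** Since [al] is linear over functions, multiplying [X] by a bump function that
    is 1 at [p] turns its local expansion into a global one without changing
    [al X p]. *)
Lemma one_form_frame (p : M) (al : one_form M) (X : vfield M) (x : 'I_n -> Cinf M)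
    (d : 'I_n -> vfield M) :
  (\forall q \near p, forall f, X f q = \sum_i X (x i) q * d i f q) ->
  al X p = \sum_i X (x i) p * al (d i) p.
Proof.
move=> fr; have [psi [psi1 psi0]] := exists_bump_function fr.
have E : psi *: X = psi *: \sum_i (X (x i)) *: d i.
  apply: vfield_eqP => f; apply: Cinf_eqP => q.
  rewrite !vfieldZE vfield_sumE CinfME [in RHS]CinfME Cinf_sumE.
  have [->|/psi0 ->] := pselect (forall f, X f q = \sum_i X (x i) q * d i f q).
    by congr (_ * _); apply: eq_bigr => i _; rewrite vfieldZE CinfME.
  by rewrite !mul0r.
have := congr1 (fun Y => al Y p) E.
rewrite !one_formZ one_form_sum !CinfME psi1 !mul1r Cinf_sumE => ->.
by apply: eq_bigr => i _; rewrite one_formZ CinfME.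
Qed.

Variable pi : poisson_structure M.

Lemma bivectorDl al be ga : pi (al + be) ga = pi al ga + pi be ga.
Proof. by have := bivector_linear pi 1 al be ga; rewrite scale1r mul1r. Qed.

Lemma bivector0l ga : pi 0 ga = 0.
Proof. by apply: (addrI (pi 0 ga)); rewrite -bivectorDl !addr0. Qed.

Lemma bivectorZl a al ga : pi (a *: al) ga = a * pi al ga.
Proof. by have := bivector_linear pi a al 0 ga; rewrite !addr0 bivector0l addr0. Qed.

Lemma bivector_suml (I : Type) (r : seq I) (al : I -> one_form M) ga :
  pi (\sum_(i <- r) al i) ga = \sum_(i <- r) pi (al i) ga.
Proof. exact: (big_morph (fun al => pi al ga) (fun al be => bivectorDl al be ga) (bivector0l ga)). Qed.

(** For [al = dfun g] this is skewness of the bracket. In general [al] is near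
    every point the combination [sum_i al (d i) *: dfun (x i)] of a local frame, which bump
    functions make into an identity between global forms. *)
Lemma sharp_dfun (al : one_form M) f :
  sharp pi al f = - al (sharp pi (dfun f)).
Proof.
apply: Cinf_eqP => p; have [c ac cp] := atlas_cover p.
have [x [d /near_join fr]] := exists_frame ac cp.
have alE : \forall q \near p, forall X : vfield M, al X q = \sum_i X (x i) q * al (d i) q.
  apply: filterS fr => q fq X; apply: one_form_frame.
  apply: filterS fq => y [cy dE vE] f'.
  by have := vE (vfield_at y X) f'; under eq_bigr do rewrite -dE.
have [psi [psi1 psi0]] := exists_bump_function alE.
have E : psi *: al = psi *: \sum_i (al (d i)) *: dfun (x i).
  apply: one_form_eqP => X; apply: Cinf_eqP => q.
  rewrite !one_formZE [LHS]CinfME [RHS]CinfME one_form_sumE Cinf_sumE.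
  have [->|/psi0 ->] := pselect (forall X : vfield M, al X q = \sum_i X (x i) q * al (d i) q).
    by congr (_ * _); apply: eq_bigr => i _; rewrite one_formZE CinfME mulrC.
  by rewrite !mul0r.
have := congr1 (fun be => pi be (dfun f) p) E.
rewrite !bivectorZl !CinfME psi1 !mul1r [LHS]/= => E1.
rewrite [LHS]E1 bivector_suml Cinf_sumE CinfNE (nbhs_singleton alE) -sumrN.
apply: eq_bigr => i _; rewrite bivectorZl CinfME.
by rewrite /sharp /= (bivector_skew pi (dfun f)) CinfNE mulNr opprK mulrC.
Qed.

Lemma bracketC f g : bracket pi f g = - bracket pi g f.
Proof. exact: bivector_skew. Qed.

Lemma bracketNr f g : bracket pi f (- g) = - bracket pi f g.
Proof. by apply: Cinf_eqP => q; exact: (tangentN (vfield_at q (sharp pi (dfun f)))). Qed.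

Lemma bracketNl f g : bracket pi (- f) g = - bracket pi f g.
Proof. by rewrite bracketC bracketNr -bracketC. Qed.

(** This is the Jacobi identity of the Poisson bracket. *)
Lemma vbracket_hamiltonian f g :
  vbracket (sharp pi (dfun f)) (sharp pi (dfun g)) = sharp pi (dfun (bracket pi f g)).
Proof.
apply: vfield_eqP => h; rewrite vbracketE.
have J := bivector_jacobi pi f g h.
change (bracket pi f (bracket pi g h) - bracket pi g (bracket pi f h) =
  bracket pi (bracket pi f g) h).
rewrite [bracket pi f h]bracketC bracketNr [RHS]bracketC opprK.
by apply/eqP; rewrite -subr_eq0 opprK; apply/eqP.
Qed.

Lemma lie_bivector_dfun X f g :
  lie_bivector pi X (dfun f) (dfun g) =
  X (bracket pi f g) - bracket pi (X f) g - bracket pi f (X g).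
Proof.
have E h : lie_form X (dfun h) = dfun (X h).
  by apply: one_form_eqP => Y; rewrite /= opprB addrC subrK.
by rewrite /lie_bivector !E.
Qed.

(** The formula [L_{pi^# al} pi = d al] on Hamiltonian vector fields: once every
    pairing with [pi^# al] is written as a value of [al], the two sides have the
    same three terms. *)
Lemma lie_bivector_sharp (al : one_form M) f g :
  lie_bivector pi (sharp pi al) (dfun f) (dfun g) =
  dform al (sharp pi (dfun f)) (sharp pi (dfun g)).
Proof.
rewrite lie_bivector_dfun /dform vbracket_hamiltonian !(sharp_dfun al).
set a := al _; set u := al _; set w := al _.
change (- a - bracket pi (- u) g - bracket pi f (- w) =
  bracket pi f w - bracket pi g u - a).
rewrite bracketNl bracketNr [bracket pi g u]bracketC.
by apply: Cinf_eqP => q; rewrite !CinfE; ring.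
Qed.

(** Hamiltonian vector fields are tangent vectors at [q], so the bracket is
    determined by its values on coordinates; [D i] stands for the partial
    derivatives at [q]. *)
Lemma bracket_frame (x : 'I_n -> Cinf M) (D : 'I_n -> Cinf M -> R) q :
  (forall (v : tangent q) f, v f = \sum_i v (x i) * D i f) ->
  forall f g, bracket pi f g q =
    \sum_i \sum_j bracket pi (x i) (x j) q * (D i f * D j g).
Proof.
move=> fr f g.
have E f' g' : bracket pi f' g' q = \sum_j bracket pi f' (x j) q * D j g'.
  exact: (fr (vfield_at q (sharp pi (dfun f'))) g').
rewrite E exchange_big /=; apply: eq_bigr => j _.
rewrite bracketC CinfNE E -sumrN mulr_suml; apply: eq_bigr => i _.
by rewrite [bracket pi (x i) _]bracketC CinfNE; ring.
Qed.

End poisson_calculus.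

(** * Functions on a product *)

Lemma derive_along_line (R : realType) (V W : normedModType R) (f : V -> R) (g : W -> R) x v y w :
  (forall h : R, f (h *: v + x) = g (h *: w + y)) -> 'D_v f x = 'D_w g y.
Proof.
move=> fg; have fgx : f x = g y by have := fg 0; rewrite !scale0r !add0r.
have E : (fun h : R => h^-1 *: (f (h *: v + x) - f x)) =
         (fun h : R => h^-1 *: (g (h *: w + y) - g y)).
  by apply/funext => h; rewrite fg fgx.
by rewrite /derive E.
Qed.

Section product.
Context {R : realType} (N1 N2 : manifold R).
Local Notation n1 := (manifold_dim N1).
Local Notation n2 := (manifold_dim N2).
Local Notation P := (prod_manifold N1 N2).
Implicit Types (c : chart R N1 n1) (d : chart R N2 n2).

Definition slicel (y : N2) (F : Cinf P) : Cinf N1 := pullback (pair_left N1 y) F.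
Definition slicer (b : N1) (F : Cinf P) : Cinf N2 := pullback (pair_right N2 b) F.

Lemma prod_chart_atlas c d : atlas c -> atlas d -> @atlas R P (prod_chart c d).
Proof. by move=> ac ad; exists c, d. Qed.

Lemma pd_slicer c d (i : 'I_n2) (F : N1 * N2 -> R) b y : chart_dom c b ->
  pd d i (fun y => F (b, y)) y =
  @pd R P (prod_chart c d) (rshift n1 i) F (b, y).
Proof.
move=> cb; apply: derive_along_line => h /=.
rewrite delta_mx_rshift scale_row_mx add_row_mx scaler0 add0r.
by rewrite !row_mxKl !row_mxKr chart_funK.
Qed.

Lemma pd_slicel c d (i : 'I_n1) (F : N1 * N2 -> R) b y : chart_dom d y ->
  pd c i (fun b => F (b, y)) b =
  @pd R P (prod_chart c d) (lshift n2 i) F (b, y).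
Proof.
move=> dy; apply: derive_along_line => h /=.
rewrite delta_mx_lshift scale_row_mx add_row_mx scaler0 add0r.
by rewrite !row_mxKl !row_mxKr chart_funK.
Qed.

Lemma smooth_snd (f : Cinf N2) : @is_smooth_fun R P (fun p => f p.2).
Proof.
move=> e [c [d [ac ad ->]]] k x [_ dx].
exact: (smooth_on_rsubmx (@chart_cod_open _ _ _ d) (CinfP f ad)).
Qed.

Lemma smooth_fst (f : Cinf N1) : @is_smooth_fun R P (fun p => f p.1).
Proof.
move=> e [c [d [ac ad ->]]] k x [cx _].
exact: (smooth_on_lsubmx (@chart_cod_open _ _ _ c) (CinfP f ac)).
Qed.

Definition pull_fst (f : Cinf N1) : Cinf P := mkCinf (smooth_fst f).
Definition pull_snd (f : Cinf N2) : Cinf P := mkCinf (smooth_snd f).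

Lemma near_slicel (b : N1) (y : N2) (Q : N1 * N2 -> Prop) :
  (\forall p \near ((b, y) : P), Q p) -> \forall b' \near b, Q (b', y).
Proof.
move=> nQ.
have cl : {for b, continuous (fun b' : N1 => (b', y))}.
  by apply: cvg_pair; [exact: cvg_id|exact: cvg_cst].
exact: (cl _ nQ).
Qed.

Lemma near_slicer (b : N1) (y : N2) (Q : N1 * N2 -> Prop) :
  (\forall p \near ((b, y) : P), Q p) -> \forall y' \near y, Q (b, y').
Proof.
move=> nQ.
have cl : {for y, continuous (fun y' : N2 => (b, y'))}.
  by apply: cvg_pair; [exact: cvg_cst|exact: cvg_id].
exact: (cl _ nQ).
Qed.

Lemma near_fst (b : N1) (y : N2) (Q : N1 -> Prop) :
  (\forall b' \near b, Q b') -> \forall p \near ((b, y) : P), Q p.1.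
Proof.
by move=> nQ; exists (Q, setT) => [|p []//]; split => //; exact: filterT.
Qed.

Lemma near_snd (b : N1) (y : N2) (Q : N2 -> Prop) :
  (\forall y' \near y, Q y') -> \forall p \near ((b, y) : P), Q p.2.
Proof.
by move=> nQ; exists (setT, Q) => [|p []//]; split => //; exact: filterT.
Qed.

(** The difference of the two sides is the value of [V] on a function that is
    constant along both slices through [(a, m)], hence has vanishing partial
    derivatives there. *)
Lemma tangent_prod_split (a : N1) (m : N2) (V : @tangent R P (a, m)) (K : Cinf P) :
  V K = V (pull_fst (slicel m K)) + V (pull_snd (slicer a K)).
Proof.
have [c ac ca] := atlas_cover a; have [d ad dm] := atlas_cover m.
have [z [D /nbhs_singleton[_ _ VE]]] :=
  @exists_frame R P _ (a, m) (prod_chart_atlas ac ad) (conj ca dm).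
pose L : Cinf P := K - pull_fst (slicel m K) - pull_snd (slicer a K).
have Ll b : L (b, m) = - K (a, m) by rewrite !CinfE /= subrr add0r.
have Lr y : L (a, y) = - K (a, m) by rewrite !CinfE /= addrAC subrr add0r.
apply/eqP; rewrite -subr_eq0 opprD addrA -!tangentB -/L VE big1 // => k _.
rewrite -(splitK k); case: (fintype.split k) => j /=.
  rewrite -(pd_slicel _ _ _ _ dm) /pd.
  by rewrite (_ : _ \o _ = cst (- K (a, m))) ?derive_cst ?mulr0 //; apply/funext => x; exact: Ll.
rewrite -(pd_slicer _ _ _ _ ca) /pd.
by rewrite (_ : _ \o _ = cst (- K (a, m))) ?derive_cst ?mulr0 //; apply/funext => x; exact: Lr.
Qed.

End product.

Lemma pd_comm (R : realType) (N : manifold R) (c : chart R N (manifold_dim N)) i j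
    (f g h : Cinf N) q : atlas c -> chart_dom c q ->
  (\forall y \near q, g y = pd c i f y) -> (\forall y \near q, h y = pd c j f y) ->
  pd c j g q = pd c i h q.
Proof.
move=> ac cq gE hE; rewrite (near_pd _ cq gE) (near_pd _ cq hE) /pd.
have E k : \forall x \near c q, (pd c k f \o chart_inv c) x =
    'D_(delta_mx 0 k) (f \o chart_inv c) x.
  have := chart_cod_near (chart_funP cq); apply: filterS => x cx.
  by rewrite /= /pd chart_invK.
rewrite (near_eq_derive _ (E i)) (near_eq_derive _ (E j)).
exact: (derive_comm _ _ (@chart_cod_open _ _ _ c) (chart_funP cq) (CinfP f ac)).
Qed.

(** * Families of functions and their brackets *)

Section families.
Context {R : realType} (N1 N2 : manifold R).
Local Notation n1 := (manifold_dim N1).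
Local Notation n2 := (manifold_dim N2).
Local Notation P := (prod_manifold N1 N2).
Implicit Types (c : chart R N1 n1) (d : chart R N2 n2) (F : Cinf P).

(** Applied to the members of a family, a tangent vector is a combination with
    constant coefficients of partial derivatives of the family; this makes it
    smooth in the parameter. *)
Lemma slicer_tangent_germ c d (b : N1) (m : N2) (v : tangent m) (y : 'I_n2 -> Cinf N2)
    (D : 'I_(n1 + n2) -> Cinf P) F : chart_dom c b ->
  (forall f, v f = \sum_i v (y i) * pd d i f m) ->
  (\forall p \near ((b, m) : P), forall k, D k p = @pd R P (prod_chart c d) k F p) ->
  \forall b' \near b, v (slicer b' F) =
    (\sum_i v (y i) *: slicel m (D (rshift n1 i))) b'.
Proof.
move=> cb vE DE; near=> b'.
have cb' : chart_dom c b' by near: b'; exact: chart_dom_near.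
have Db' k : D k (b', m) = @pd R P (prod_chart c d) k F (b', m).
  by move: k; near: b'; exact: near_slicel DE.
rewrite vE Cinf_sumE; apply: eq_bigr => i _; rewrite CinfZE /= Db'.
by rewrite -pd_slicer.
Unshelve. all: by end_near. Qed.

Lemma slicel_tangent_germ c d (b : N1) (m : N2) (w : tangent b) (x : 'I_n1 -> Cinf N1)
    (D : 'I_(n1 + n2) -> Cinf P) F : chart_dom d m ->
  (forall f, w f = \sum_i w (x i) * pd c i f b) ->
  (\forall p \near ((b, m) : P), forall k, D k p = @pd R P (prod_chart c d) k F p) ->
  \forall m' \near m, w (slicel m' F) =
    (\sum_i w (x i) *: slicer b (D (lshift n2 i))) m'.
Proof.
move=> dm wE DE; near=> m'.
have dm' : chart_dom d m' by near: m'; exact: chart_dom_near.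
have Dm' k : D k (b, m') = @pd R P (prod_chart c d) k F (b, m').
  by move: k; near: m'; exact: near_slicer DE.
rewrite wE Cinf_sumE; apply: eq_bigr => i _; rewrite CinfZE /= Dm'.
by rewrite -pd_slicel.
Unshelve. all: by end_near. Qed.

Lemma exists_partials c d F (b : N1) (m : N2) : atlas c -> atlas d ->
  chart_dom c b -> chart_dom d m ->
  exists D : 'I_(n1 + n2) -> Cinf P, \forall p \near ((b, m) : P),
    forall k, D k p = @pd R P (prod_chart c d) k F p.
Proof.
move=> ac ad cb dm.
have [z [D DE]] := @exists_frame R P _ (b, m) (prod_chart_atlas ac ad) (conj cb dm).
by exists (fun k => D k F); apply: filterS DE => p [_ DE _] k.
Qed.

Lemma slicer_tangent_smooth (m : N2) (v : tangent m) F :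
  is_smooth_fun (fun b => v (slicer b F)).
Proof.
apply: smooth_fun_of_germs => b.
have [c ac cb] := atlas_cover b; have [d ad dm] := atlas_cover m.
have [y [_ /nbhs_singleton[_ _ VE]]] := exists_frame ad dm.
have [D DE] := exists_partials F ac ad cb dm.
exists (\sum_i v (y i) *: slicel m (D (rshift n1 i))).
exact: (slicer_tangent_germ cb (VE v) DE).
Qed.

Lemma slicel_tangent_smooth (b : N1) (w : tangent b) F :
  is_smooth_fun (fun m => w (slicel m F)).
Proof.
apply: smooth_fun_of_germs => m.
have [c ac cb] := atlas_cover b; have [d ad dm] := atlas_cover m.
have [x [_ /nbhs_singleton[_ _ WE]]] := exists_frame ac cb.
have [D DE] := exists_partials F ac ad cb dm.
exists (\sum_i w (x i) *: slicer b (D (lshift n2 i))).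
exact: (slicel_tangent_germ dm (WE w) DE).
Qed.

Definition deriver (m : N2) (v : tangent m) F : Cinf N1 := mkCinf (slicer_tangent_smooth v F).
Definition derivel (b : N1) (w : tangent b) F : Cinf N2 := mkCinf (slicel_tangent_smooth w F).

(** In product charts both sides are combinations, with the same coefficients, of
    second derivatives of [F], one in each factor, taken in opposite orders. *)
Lemma derive_slices_comm (b : N1) (m : N2) (w : tangent b) (v : tangent m) F :
  w (deriver v F) = v (derivel w F).
Proof.
have [c ac cb] := atlas_cover b; have [d ad dm] := atlas_cover m.
have [y [_ /nbhs_singleton[_ _ VE]]] := exists_frame ad dm.
have [x [_ /nbhs_singleton[_ _ WE]]] := exists_frame ac cb.
have [D DE] := exists_partials F ac ad cb dm.
rewrite (@tangent_near _ _ _ w (deriver v F) _ (slicer_tangent_germ cb (VE v) DE)).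
rewrite (@tangent_near _ _ _ v (derivel w F) _ (slicel_tangent_germ dm (WE w) DE)).
rewrite !tangent_sum.
under eq_bigr do rewrite tangentZ WE mulr_sumr.
under [in RHS]eq_bigr do rewrite tangentZ VE mulr_sumr.
rewrite exchange_big /=; apply: eq_bigr => j _; apply: eq_bigr => i _.
rewrite mulrCA; congr (_ * (_ * _)).
rewrite (pd_slicel c j (D (rshift n1 i)) b dm) (pd_slicer d i (D (lshift n2 j)) m cb).
apply: (@pd_comm R P _ _ _ F).
- exact: prod_chart_atlas.
- by split.
- by apply: filterS DE => p.
- by apply: filterS DE => p.
Qed.

Variable pi : poisson_structure N2.

Definition slice_bracket F F' (p : P) : R :=
  bracket pi (slicer p.1 F) (slicer p.1 F') p.2.

Lemma slice_bracket_smooth F F' : is_smooth_fun (slice_bracket F F').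
Proof.
apply: smooth_fun_of_germs => -[b m].
have [c ac cb] := atlas_cover b; have [d ad dm] := atlas_cover m.
have [x [dx fr]] := exists_frame ad dm.
have [D DE] := exists_partials F ac ad cb dm.
have [D' DE'] := exists_partials F' ac ad cb dm.
exists (\sum_i \sum_j pull_snd N1 (bracket pi (x i) (x j)) *
  (D (rshift n1 i) * D' (rshift n1 j))).
have cb1 := @near_fst _ N1 N2 b m _ (chart_dom_near cb).
have fr2 := @near_snd _ N1 N2 b m _ fr.
near=> p.
have cp : chart_dom c p.1 by near: p.
have [_ _ vE] : [/\ chart_dom d p.2,
        forall i (f : Cinf N2), dx i f p.2 = pd d i f p.2 &
        forall (v : tangent p.2) f, v f = \sum_i v (x i) * pd d i f p.2] by near: p.
have Dp k : D k p = @pd R P (prod_chart c d) k F (p.1, p.2).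
  by rewrite -surjective_pairing; move: k; near: p.
have Dp' k : D' k p = @pd R P (prod_chart c d) k F' (p.1, p.2).
  by rewrite -surjective_pairing; move: k; near: p.
rewrite /slice_bracket (bracket_frame pi vE) Cinf_sumE.
apply: eq_bigr => i _; rewrite Cinf_sumE; apply: eq_bigr => j _.
by rewrite !CinfME Dp Dp' -!pd_slicer.
Unshelve. all: by end_near. Qed.

Definition slice_bracket_fun F F' : Cinf P := mkCinf (slice_bracket_smooth F F').

(** At a fixed point [m] the bracket is a bilinear form in the partial derivatives
    of the two families at [m], with constant coefficients. Apply the product rule in the
    parameter and commute [w] with these partial derivatives. *)
Lemma slice_bracket_leibniz (a : N1) (m : N2) (w : tangent a) F F' :
  w (slicel m (slice_bracket_fun F F')) =
  bracket pi (derivel w F) (slicer a F') m + bracket pi (slicer a F) (derivel w F') m.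
Proof.
have [d ad dm] := atlas_cover m.
have [x [_ /nbhs_singleton[_ _ VE]]] := exists_frame ad dm.
pose v i := pd_tangent i ad dm.
have -> : slicel m (slice_bracket_fun F F') =
    \sum_i \sum_j bracket pi (x i) (x j) m *: (deriver (v i) F * deriver (v j) F').
  apply: Cinf_eqP => b; rewrite [LHS](bracket_frame pi VE) Cinf_sumE.
  apply: eq_bigr => i _; rewrite Cinf_sumE; apply: eq_bigr => j _.
  by rewrite CinfZE CinfME.
rewrite !(bracket_frame pi VE) -big_split tangent_sum /=.
apply: eq_bigr => i _; rewrite -big_split tangent_sum /=.
apply: eq_bigr => j _; rewrite tangentZ tangentM !derive_slices_comm.
rewrite [deriver _ _ _]/= [deriver (v j) _ _]/= /v /=.
by ring.
Qed.

End families.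

(** * Smooth maps, and functions with vanishing derivative *)

Section smooth_maps.
Context {R : realType}.

Lemma smooth_id (N : manifold R) : @is_smooth_map R N N id.
Proof. by split=> [x|c d ac ad]; [exact: cvg_id|exact: atlas_compatible]. Qed.

Lemma smooth_comp (N N' N'' : manifold R) (F : N -> N') (G : N' -> N'') :
  is_smooth_map F -> is_smooth_map G -> is_smooth_map (G \o F).
Proof.
move=> [cF sF] [cG sG]; split=> [x|c e ac ae j k x [cx ex]].
  by apply: continuous_comp; [exact: cF|exact: cG].
have [d ad dx] := atlas_cover (F (chart_inv c x)).
pose V := [set y | chart_cod d y /\ chart_dom e (G (chart_inv d y))].
pose U := [set x | chart_cod c x /\ chart_dom d (F (chart_inv c x))].
have oU : open U by exact: smooth_in_charts_open.
pose U' := [set x | chart_cod c x /\ chart_dom e (G (F (chart_inv c x)))].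
have oU' : open U'.
  apply: (@smooth_in_charts_open _ _ _ _ _ c e (G \o F)) => y.
  by apply: continuous_comp; [exact: cF|exact: cG].
have oUU : open (U `&` U') by exact: openI.
apply: (@eq_Ck_on _ _ _ (U `&` U') ((fun y => e (G (chart_inv d y)) 0 j) \o
    (fun y => d (F (chart_inv c y))))) => //.
  by move=> y /[1!inE] -[[_ dy] _] /=; rewrite chart_funK.
apply: (@Ck_on_comp _ _ _ _ _ _ (fun y => e (G (chart_inv d y)) 0 j)) => //.
  by move=> i y [Uy _]; exact: (sF c d ac ad i).
move=> y [[cy dy] [_ ey]]; apply: (sG d e ad ae j); split; first exact: chart_funP.
by rewrite chart_funK.
Qed.

Lemma smooth_pair (N N1 N2 : manifold R) (F : N -> N1) (G : N -> N2) :
  is_smooth_map F -> is_smooth_map G ->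
  @is_smooth_map R N (prod_manifold N1 N2) (fun x => (F x, G x)).
Proof.
move=> [cF sF] [cG sG]; split=> [x|c _ ac [d [e [ad ae ->]]] j k x [cx [/= dx ex]]].
  by apply: cvg_pair; [exact: cF|exact: cG].
rewrite -(splitK j); case: (fintype.split j) => i /=.
  by under eq_fun do rewrite row_mxEl; exact: (sF c d ac ad).
by under eq_fun do rewrite row_mxEr; exact: (sG c e ac ae).
Qed.

Definition comp_map (N N' N'' : manifold R) (G : smooth_map N' N'') (F : smooth_map N N') :
  smooth_map N N'' := SmoothMap (smooth_comp (smooth_mapP F) (smooth_mapP G)).
Definition id_map (N : manifold R) : smooth_map N N := SmoothMap (smooth_id N).
Definition pair_map (N N1 N2 : manifold R) (F : smooth_map N N1) (G : smooth_map N N2) :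
  smooth_map N (prod_manifold N1 N2) := SmoothMap (smooth_pair (smooth_mapP F) (smooth_mapP G)).

Lemma push_subproof (N N' : manifold R) (F : smooth_map N N') (p : N) (v : tangent p) :
  is_tangent (F p) (fun f => v (pullback F f)).
Proof.
split=> [a f g|f g].
  by rewrite -tangentL; congr (v _); exact: Cinf_eqP.
by rewrite -[_ * v _ + _](tangentM v (pullback F f)); congr (v _); exact: Cinf_eqP.
Qed.

Definition push (N N' : manifold R) (F : smooth_map N N') (p : N) (v : tangent p) :
  tangent (F p) := mkTangent (push_subproof F v).

Lemma locally_cst_of_tangents (N : manifold R) (f : Cinf N) (b : N) :
  (forall q (v : tangent q), v f = 0) -> \forall q \near b, f q = f b.
Proof.
move=> f0; have [c ac cb] := atlas_cover b.
have := @derive0_locally_cst R _ (chart_cod c) (f \o chart_inv c) (c b)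
  (@chart_cod_open _ _ _ c) (chart_funP cb).
move=> /(_ _ _)/(chart_fun_near cb) H.
have H1 : \forall q \near b, (f \o chart_inv c) (c q) = (f \o chart_inv c) (c b).
  apply: H => [x cx|x i cx]; first exact: (CinfP f ac 1%N cx).1.
  have := f0 _ (pd_tangent i ac (chart_invP cx)).
  by rewrite /= /pd chart_invK.
near=> q; have cq : chart_dom c q by near: q; exact: chart_dom_near.
rewrite -[q in LHS](chart_funK cq) -[b in RHS](chart_funK cb).
by near: q.
Unshelve. all: by end_near. Qed.

Lemma cst_of_tangents (N : manifold R) (f : Cinf N) (a b : N) :
  connected [set: N] -> (forall q (v : tangent q), v f = 0) -> f a = f b.
Proof.
move=> cN f0; have lc q := locally_cst_of_tangents q f0.
pose B := [set q | f q = f b].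
have -> // : B a.
suff -> : B = setT by [].
apply: cN; first by exists b.
  exists B; last by rewrite setTI.
  rewrite openE => q Bq; apply: filterS (lc q) => y; rewrite /B /= => ->; exact: Bq.
exists B; last by rewrite setTI.
rewrite -[B]setCK; apply: open_closedC; rewrite openE => q nBq.
by apply: filterS (lc q) => y; rewrite /B /= => ->.
Qed.

End smooth_maps.

(** * Poisson Lie groups *)

Section lie_groups.
Context {R : realType} (G : lie_group R).
Local Notation e := (lie_one G).
Local Notation "x ** y" := (lie_mul G (x, y)) (at level 40, left associativity).
Local Notation inv := (lie_inv G).

Lemma lie_mulrV x : x ** inv x = e.
Proof.
rewrite -[LHS]lie_mul1 -{1}(lie_mulV (inv x)) -lie_mulA.
by rewrite [inv x ** _]lie_mulA lie_mulV lie_mul1 lie_mulV.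
Qed.

Lemma lie_mulr1 x : x ** e = x.
Proof. by rewrite -(lie_mulV x) lie_mulA lie_mulrV lie_mul1. Qed.

Lemma lie_inv_uniq x y : x ** y = e -> x = inv y.
Proof. by move=> xy; rewrite -[x]lie_mulr1 -(lie_mulrV y) lie_mulA xy lie_mul1. Qed.

Lemma lie_inv1 : inv e = e.
Proof. by rewrite -[LHS]lie_mulr1 lie_mulV. Qed.

Lemma lie_invM x y : inv (x ** y) = inv y ** inv x.
Proof.
apply/esym/lie_inv_uniq; rewrite lie_mulA -[inv y ** _ ** x]lie_mulA.
by rewrite lie_mulV lie_mulr1 lie_mulV.
Qed.

(** The inverse of [c t] is [c (- t)]. *)
Lemma lie_algebra_inv (xi : lie_algebra G) c (k : Cinf G) :
  one_parameter_subgroup xi c -> xi (pullback inv k) = - xi k.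
Proof.
move=> [_ cD dc].
have c0 : c 0 = e.
  have := cD 0 0; rewrite addr0 => /(congr1 (fun z => inv (c 0) ** z)).
  by rewrite lie_mulA lie_mulV lie_mul1.
have cN t : inv (c t) = c (- t).
  by apply/esym/lie_inv_uniq; rewrite -cD addNr c0.
have d1 := dc (pullback inv k).
have d2 : is_derive (0 : R) 1 ((k \o c) \o -%R) (xi k * -1).
  have d0 : is_derive (- (0 : R)) 1 (k \o c) (xi k) by rewrite oppr0; exact: dc.
  exact: is_derive1_comp.
have E : pullback inv k \o c = (k \o c) \o -%R.
  by apply/funext => t; rewrite /= cN.
rewrite E in d1.
by rewrite -(derive_val (is_derive := d1)) (derive_val (is_derive := d2)) mulrN1.
Qed.

Variable piG : poisson_structure G.
Hypothesis piG_mult : multiplicative piG.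

Lemma multiplicativeE f g x y : bracket piG f g (x ** y) =
  bracket piG (slicel y (pullback (lie_mul G) f)) (slicel y (pullback (lie_mul G) g)) x +
  bracket piG (slicer x (pullback (lie_mul G) f)) (slicer x (pullback (lie_mul G) g)) y.
Proof. by rewrite -piG_mult. Qed.

(** Multiplicativity at [(e, e)] reads [{f, g}(e) = {f, g}(e) + {f, g}(e)]. *)
Lemma bracket_at_one f g : bracket piG f g e = 0.
Proof.
have l h : slicel e (pullback (lie_mul G) h) = h.
  by apply: Cinf_eqP => x /=; rewrite lie_mulr1.
have r h : slicer e (pullback (lie_mul G) h) = h.
  by apply: Cinf_eqP => x /=; rewrite lie_mul1.
have := multiplicativeE f g e e; rewrite lie_mul1 !l !r => /eqP.
by rewrite -subr_eq0 opprD addrA subrr add0r oppr_eq0 => /eqP.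
Qed.

(** As the Poisson structure vanishes at [e], only the term [X {f, g}] of
    [(L_X piG)(df, dg)] survives there, and [(f, g) |-> xi {f, g}] satisfies the
    Leibniz rule at [e] in each argument. Being skew, it is determined by an
    antisymmetric matrix [B] of values on coordinates; halving [B] compensates for the
    two terms of each wedge product. *)
Lemma exists_cobracket (xi : lie_algebra G) : exists2 w, is_cobracket piG xi w &
  forall f g, xi (bracket piG f g) = \sum_(ab <- w) (ab.1 f * ab.2 g - ab.1 g * ab.2 f).
Proof.
have [c ac ce] := atlas_cover e.
have [x [d /nbhs_singleton[_ dE vE]]] := exists_frame ac ce.
pose X : vfield G := \sum_i (xi (x i) *: (1 : Cinf G)) *: d i.
have Xe : vfield_at e X = xi.
  apply: tangent_eqP => f; rewrite [LHS]/= -[LHS]/(X f e) /X vfield_sumE Cinf_sumE vE.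
  by apply: eq_bigr => i _; rewrite vfieldZE CinfME CinfZE mulr1 dE.
have lieE f g : lie_bivector piG X (dfun f) (dfun g) e = xi (bracket piG f g).
  rewrite lie_bivector_dfun !CinfE !bracket_at_one !subr0.
  by rewrite -[LHS]/(vfield_at e X _) Xe.
pose B i j := xi (bracket piG (x i) (x j)).
have [t tE] : exists t : 'I_(manifold_dim G) -> tangent e,
    forall i f, t i f = pd c i f e by exists (fun i => pd_tangent i ac ce).
have vt (v : tangent e) f : v f = \sum_i v (x i) * t i f.
  by rewrite vE; under eq_bigr do rewrite -tE.
pose w := [seq (((B ij.1 ij.2 / 2) *: t ij.1 : lie_algebra G), (t ij.2 : lie_algebra G))
  | ij <- index_enum ('I_(manifold_dim G) * 'I_(manifold_dim G))%type].
have xiE f g : xi (bracket piG f g) = \sum_(ab <- w) (ab.1 f * ab.2 g - ab.1 g * ab.2 f).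
  have dP h : is_tangent e (fun g => xi (bracket piG h g)).
    split=> [a g1 g2|g1 g2].
      by rewrite -tangentL -[bracket piG h _]/(sharp piG (dfun h) _) vfieldL.
    rewrite -[bracket piG h (_ * _)]/(sharp piG (dfun h) _) vfieldM tangentD !tangentM.
    rewrite -!/(bracket piG h _) -[sharp piG (dfun h) _]/(bracket piG h _).
    rewrite -[sharp piG (dfun h) _]/(bracket piG h _) !bracket_at_one.
    by rewrite !mul0r !addr0.
  have E h g' : xi (bracket piG h g') = \sum_j xi (bracket piG h (x j)) * t j g'.
    exact: (vt (mkTangent (dP h)) g').
  have S f' g' : xi (bracket piG f' g') = \sum_i \sum_j B i j * (t i f' * t j g').
    rewrite E exchange_big /=; apply: eq_bigr => j _.
    rewrite bracketC tangentN E -sumrN mulr_suml; apply: eq_bigr => i _.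
    by rewrite /B [bracket piG (x i) _]bracketC tangentN; ring.
  have -> : xi (bracket piG f g) = xi (bracket piG f g) / 2 - xi (bracket piG g f) / 2.
    by rewrite [bracket piG g f]bracketC tangentN; field.
  rewrite !S /w big_map -(pair_bigA _ (fun i j =>
    (B i j / 2 *: t i : lie_algebra G) f * t j g - (B i j / 2 *: t i : lie_algebra G) g * t j f)) /=.
  rewrite !mulr_suml -sumrB; apply: eq_bigr => i _.
  rewrite !mulr_suml -sumrB; apply: eq_bigr => j _.
  change (B i j * (t i f * t j g) / 2 - B i j * (t i g * t j f) / 2 =
    (B i j / 2 * t i f) * t j g - (B i j / 2 * t i g) * t j f).
  by ring.
by exists w => //; exists X => // f g; rewrite lieE xiE.
Qed.

End lie_groups.

(** * The defect of an action from being Poisson *)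

Section defect.
Context {R : realType} (G : lie_group R) (piG : poisson_structure G).
Context (M : manifold R) (pi : poisson_structure M).
Variable Phi : smooth_map (prod_manifold G M) M.
Hypothesis piG_mult : multiplicative piG.
Hypothesis Phi_action : is_action Phi.
Local Notation e := (lie_one G).
Local Notation "x ** y" := (lie_mul G (x, y)) (at level 40, left associativity).
Local Notation inv := (lie_inv G).
Local Notation mulf u := (pullback (lie_mul G) u).
Local Notation actf f := (pullback Phi f).

Lemma act1 m : Phi (e, m) = m. Proof. exact: Phi_action.1. Qed.
Lemma actM a b m : Phi (a ** b, m) = Phi (a, Phi (b, m)). Proof. exact: Phi_action.2. Qed.

Definition orbit_fun (m : M) (f : Cinf M) : Cinf G := slicel m (actf f).

Definition inv_id : smooth_map G (prod_manifold G G) :=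
  pair_map inv (id_map G).
Definition inv_orbit (m : M) : smooth_map G (prod_manifold G M) :=
  pair_map inv (comp_map Phi (pair_left G m)).

Definition defect (f g : Cinf M) (m : M) : Cinf G :=
  pullback inv_id (slice_bracket_fun piG (mulf (orbit_fun m f)) (mulf (orbit_fun m g)))
  + bracket pi f g m *: (1 : Cinf G)
  - pullback (inv_orbit m) (slice_bracket_fun pi (actf f) (actf g)).

Lemma defectE f g m b : defect f g m b =
  bracket piG (slicer (inv b) (mulf (orbit_fun m f)))
              (slicer (inv b) (mulf (orbit_fun m g))) b
  + bracket pi f g m
  - bracket pi (slicer (inv b) (actf f)) (slicer (inv b) (actf g)) (Phi (b, m)).
Proof. by rewrite !CinfE mulr1. Qed.

(** Multiplicativity splits the bracket of G at [x ** b]: one summand belongs to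
    the defect at [x], the other one to the defect at [b]. The remaining terms at
    the point [Phi (b, m)] cancel. *)
Lemma defect_cocycle f g m x b : defect f g m (x ** b) =
  defect (slicer (inv b) (actf f)) (slicer (inv b) (actf g)) (Phi (b, m)) x
  + defect f g m b.
Proof.
rewrite !defectE (multiplicativeE piG_mult) actM.
have E1 h : slicel b (mulf (slicer (inv (x ** b)) (mulf (orbit_fun m h)))) =
    slicer (inv x) (mulf (orbit_fun (Phi (b, m)) (slicer (inv b) (actf h)))).
  by apply: Cinf_eqP => y /=; rewrite lie_invM -!actM !lie_mulA.
have E2 h : slicer x (mulf (slicer (inv (x ** b)) (mulf (orbit_fun m h)))) =
    slicer (inv b) (mulf (orbit_fun m h)).
  apply: Cinf_eqP => y /=; rewrite lie_invM; congr (h (Phi (_, _))).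
  by rewrite -lie_mulA [inv x ** _]lie_mulA lie_mulV lie_mul1.
have E3 h : slicer (inv (x ** b)) (actf h) =
    slicer (inv x) (actf (slicer (inv b) (actf h))).
  by apply: Cinf_eqP => y /=; rewrite lie_invM actM.
by rewrite !E1 !E2 !E3; ring.
Qed.

Lemma slicer1 (h : Cinf M) : slicer e (actf h) = h.
Proof. by apply: Cinf_eqP => y /=; rewrite act1. Qed.

Lemma slicer_mul1 (h : Cinf G) : slicer e (mulf h) = h.
Proof. by apply: Cinf_eqP => y /=; rewrite lie_mul1. Qed.

Variable phi : lie_algebra G -> one_form M.
Hypothesis mm : infinitesimal_momentum_map piG pi Phi phi.

Lemma momentum_vfieldE (xi : lie_algebra G) f m : sharp pi (phi xi) f m = xi (orbit_fun m f).
Proof.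
have [c [_ _ dc] gc] := momentum_generator mm xi.
have d1 := dc (orbit_fun m f); have d2 := gc f m.
by rewrite -(derive_val (is_derive := d1)) -(derive_val (is_derive := d2)).
Qed.

Lemma momentum_inv (xi : lie_algebra G) (k : Cinf G) : xi (pullback inv k) = - xi k.
Proof. by have [c hc _] := momentum_generator mm xi; exact: lie_algebra_inv hc. Qed.

(** Both sides are evaluations of [delta(xi)] on the pair of functions: the left
    one by definition of the cobracket, the right one because it equals
    [d(phi_xi)] on Hamiltonian vector fields, and the momentum map sends
    [delta(xi)] to [d(phi_xi)]. *)
Lemma infinitesimal_poisson_action (xi : lie_algebra G) f g m :
  xi (bracket piG (orbit_fun m f) (orbit_fun m g)) =
  lie_bivector pi (sharp pi (phi xi)) (dfun f) (dfun g) m.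
Proof.
have [w wxi ->] := exists_cobracket piG_mult xi.
rewrite lie_bivector_sharp (momentum_cobracket mm wxi) Cinf_sumE.
apply: eq_bigr => ab _.
have phiE h zeta : phi zeta (sharp pi (dfun h)) m = - zeta (orbit_fun m h).
  by rewrite -momentum_vfieldE sharp_dfun CinfNE opprK.
by rewrite /wedge !CinfE !phiE; ring.
Qed.

(** Both variable terms of the defect are a function on a product, restricted to a
    curve [(b^-1, b)] or [(b^-1, b m)]; [tangent_prod_split] separates the two
    occurrences of [b]. For the bracket of G the contribution of [b^-1] vanishes
    with the bracket at [e]. *)
Lemma defect_tangent1 (xi : lie_algebra G) f g m : xi (defect f g m) = 0.
Proof.
pose K1 := slice_bracket_fun piG (mulf (orbit_fun m f)) (mulf (orbit_fun m g)).
pose K2 := slice_bracket_fun pi (actf f) (actf g).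
have T1 : xi (pullback inv_id K1) = xi (bracket piG (orbit_fun m f) (orbit_fun m g)).
  rewrite -[LHS]/(push inv_id xi K1) (tangent_prod_split (push inv_id xi)) /=.
  rewrite (_ : pullback inv_id (pull_fst _ _) = 0); last first.
    by apply: Cinf_eqP => b; rewrite /= [LHS](bracket_at_one piG_mult).
  rewrite tangent0 add0r; congr (xi _); apply: Cinf_eqP => b /=.
  by rewrite /slice_bracket /= lie_inv1 !slicer_mul1.
have T2 : xi (pullback (inv_orbit m) K2) =
    lie_bivector pi (sharp pi (phi xi)) (dfun f) (dfun g) m.
  rewrite lie_bivector_dfun -[LHS]/(push (inv_orbit m) xi K2) (tangent_prod_split (push (inv_orbit m) xi)) /=.
  rewrite (_ : pullback _ (pull_fst _ _) = pullback inv (slicel m K2)); last first.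
    by apply: Cinf_eqP => b /=; rewrite act1.
  rewrite (_ : pullback _ (pull_snd _ _) = orbit_fun m (bracket pi f g)); last first.
    by apply: Cinf_eqP => b; rewrite /= /slice_bracket /= lie_inv1 !slicer1.
  rewrite momentum_inv slice_bracket_leibniz !slicer1 -momentum_vfieldE.
  have D h : derivel xi (actf h) = sharp pi (phi xi) h.
    by apply: Cinf_eqP => y; rewrite momentum_vfieldE.
  by rewrite !D addrC opprD addrA.
rewrite tangentB tangentD tangentZ tangent1 mulr0 addr0 T1 T2.
by rewrite infinitesimal_poisson_action subrr.
Qed.

(** Right translation by [b^-1] carries [v] to a vector at [e] and, by the cocycle
    property, the defect to another defect plus a constant. *)
Lemma defect_tangent (b : G) (v : tangent b) f g m : v (defect f g m) = 0.
Proof.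
have xiP : is_tangent e (fun k => v (slicel (inv b) (mulf k))).
  pose S := comp_map (lie_mul G) (pair_left G (inv b)).
  have SE k : slicel (inv b) (mulf k) = pullback S k by exact: Cinf_eqP.
  have := push_subproof S v; rewrite {1}/S [X in is_tangent X]/= lie_mulrV.
  by move=> [vl vM]; split=> [a k l|k l]; rewrite !SE; [exact: vl|exact: vM].
pose k := defect (slicer (inv b) (actf f)) (slicer (inv b) (actf g)) (Phi (b, m))
  + defect f g m b *: (1 : Cinf G).
have kE y : k y = defect (slicer (inv b) (actf f)) (slicer (inv b) (actf g))
    (Phi (b, m)) y + defect f g m b.
  by rewrite [LHS]CinfDE [X in _ + X]CinfZE mulr1.
have -> : defect f g m = slicel (inv b) (mulf k).
  apply: Cinf_eqP => y; rewrite -[RHS]/(k (y ** inv b)) kE.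
  by rewrite -defect_cocycle -lie_mulA lie_mulV lie_mulr1.
rewrite -[LHS]/(mkTangent xiP k) tangentD tangentZ tangent1 mulr0 addr0.
exact: defect_tangent1.
Qed.

Lemma defect0 f g m b : connected [set: G] -> defect f g m b = 0.
Proof.
move=> cG; rewrite (cst_of_tangents b e cG); last by move=> q v; exact: defect_tangent.
rewrite defectE (bracket_at_one piG_mult) lie_inv1 !slicer1 act1.
by rewrite add0r subrr.
Qed.

End defect.

Theorem proposition3p13 (R : realType) (G : lie_group R)
    (piG : poisson_structure G) (M : manifold R) (pi : poisson_structure M)
    (Phi : smooth_map (prod_manifold G M) M)
    (phi : lie_algebra G -> one_form M) :
  multiplicative piG ->
  connected [set: G] ->
  simply_connected R G ->
  is_action Phi ->
  infinitesimal_momentum_map piG pi Phi phi ->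
  is_poisson_map (prod_bracket piG pi) pi Phi.
Proof.
move=> piG_mult cG _ Phi_action mm f g [a m].
(* translating f and g by a undoes the translation by a^-1 in the defect at a *)
have := defect0 piG_mult Phi_action mm (slicer a (pullback Phi f))
  (slicer a (pullback Phi g)) m a cG.
rewrite defectE => /eqP; rewrite subr_eq0 => /eqP.
have E1 h : slicer (lie_inv G a) (pullback (lie_mul G)
    (orbit_fun Phi m (slicer a (pullback Phi h)))) = slicel m (pullback Phi h).
  apply: Cinf_eqP => y /=; rewrite -(actM Phi_action) lie_mulA lie_mulrV.
  by rewrite lie_mul1.
have E2 h : slicer (lie_inv G a) (pullback Phi (slicer a (pullback Phi h))) = h.
  by apply: Cinf_eqP => y /=; rewrite -(actM Phi_action) lie_mulrV (act1 Phi_action).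
by rewrite !E1 !E2.
Qed.
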